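(* Let $G=(V,E,\mu,w)$ be a connected, locally finite and stochastically complete graph. Let $s\in(0,1)$, $p\in[2,+\infty)$ and assume $\inf_{x\in V}\mu(x)>0$. Then the fractional Sobolev space $W^{s,p}(V)$ satisfies the following properties: (i) $C_c(V)\subseteq W^{s,p}(V)$; (ii) $W^{s,p}(V)$ is a reflexive Banach space; (iii) $W^{s,p}(V)$ is embedded in $L^q(V)$ for all $q\in[p,+\infty]$; (iv) if $u\in W^{s,p}(V)$, then $u^+,u^-,|u|\in W^{s,p}(V)$, where $u^+=\max\{u,0\}$, $u^-=\min\{u,0\}$ and $|u|=u^+-u^-$.
   Context: $G=(V,E,\mu,w)$ is a weighted graph with countable vertex set $V$, edge set $E$, positive vertex measure $\mu:V\to(0,+\infty)$ and positive symmetric edge weight $w_{xy}=w_{yx}>0$ ($xy\in E$); locally finite means every vertex has finitely many neighbours. Write $\int_V g\,d\mu=\sum_{x\in V}g(x)\mu(x)$. Let $p(t,x,y)$ be the (minimal) heat kernel of $G$, i.e. of the Laplacian $\Delta u(x)=\frac1{\mu(x)}\sum_{y\sim x}w_{xy}(u(y)-u(x))$. $G$ is stochastically complete if $\sum_{y\in V}p(t,x,y)\mu(y)=1$ for all $t>0$, $x\in V$. (The exponent $p$ below is unrelated to the heat kernel.) For $s\in(0,1)$ and $x\ne y\in V$, set $$W_s(x,y)=\frac{s}{\Gamma(1-s)}\mu(x)\mu(y)\int_0^{+\infty}p(t,x,y)\,t^{-1-s}\,dt,$$ where $\Gamma(\cdot)$ is the Gamma function. $L^q(V)$, $1\le q<\infty$,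 is the space of functions $u:V\to\mathbb R$ with $\|u\|_{L^q(V)}=(\int_V|u|^qd\mu)^{1/q}<\infty$; $L^\infty(V)$ is the space of bounded functions with norm $\sup_V|u|$. For $u\in L^\infty(V)$, $$|\nabla^su|(x)=\Big(\frac1{2\mu(x)}\sum_{y\in V,\,y\ne x}W_s(x,y)(u(x)-u(y))^2\Big)^{1/2}.$$ $C_c(V)$ is the set of functions $u:V\to\mathbb R$ with finite support. For $s\in(0,1)$, $p\in[2,+\infty)$, $$W^{s,p}(V)=\Big\{u\in L^\infty(V):\int_V(|\nabla^su|^p+|u|^p)\,d\mu<+\infty\Big\},\qquad \|u\|_{W^{s,p}(V)}=\Big(\int_V(|\nabla^su|^p+|u|^p)\,d\mu\Big)^{1/p}.$$ ''Embedded'' means contained with continuous (bounded) inclusion map. *)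

(* Defs.v *)
(* MathComp-Analysis, over an arbitrary [R : realType]. *)
From HB Require Import structures.
From mathcomp Require Export all_boot all_order all_algebra.
From mathcomp Require Export all_classical all_reals all_analysis.
Export Order.TTheory GRing.Theory Num.Theory.
Export numFieldNormedType.Exports.

Set Implicit Arguments.
Unset Strict Implicit.
Unset Printing Implicit Defensive.

Global Open Scope classical_set_scope.
Global Open Scope ring_scope.

(** The edge weight is a total function, but only its values on edges are
    constrained, and only those are ever used. *)
Record weighted_graph (R : realType) (V : countType) := WeightedGraph {
  edge : rel V;
  edge_sym : symmetric edge;
  vmeas : V -> R;
  vmeas_gt0 : forall x, 0 < vmeas x;
  weight : V -> V -> R;
  weight_sym : forall x y, edge x y -> weight x y = weight y x;
  weight_gt0 : forall x y, edge x y -> 0 < weight x y }.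

Definition Gamma (R : realType) (a : R) : R :=
  \int[lebesgue_measure]_(t in `]0, +oo[) (t `^ (a - 1) * expR (- t)).

Section Graph.
Context {R : realType} {V : countType}.
Variable G : weighted_graph R V.
Local Notation mu := (vmeas G).

Definition connected_graph : Prop :=
  forall x y : V, exists s : seq V, path (edge G) x s /\ last x s = y.

Definition locally_finite : Prop :=
  forall x : V, finite_set [set y | edge G x y].

(** The sum is finitely supported when [G] is locally finite. *)
Definition laplacian (u : V -> R) (x : V) : R :=
  (mu x)^-1 * \sum_(y \in [set y | edge G x y]) (weight G x y * (u y - u x)).

Definition dirichlet_laplacian (K : set V) (u : V -> R) (x : V) : R :=
  \1_K x * laplacian (fun z => \1_K z * u z) x.

(** [p_K(t,x,y) = (exp(t Delta_K) (1_{y} / mu y)) x], with the exponential of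
    the Dirichlet Laplacian of the finite set [K] given by its power series;
    it vanishes unless both [x] and [y] belong to [K]. *)
Definition dirichlet_heat_kernel (K : set V) (t : R) (x y : V) : R :=
  limn (series (fun n : nat => t ^+ n / n`!%:R *
    iter n (dirichlet_laplacian K) (fun z => \1_(K `&` [set y]) z / mu y) x)).

(** Minimal heat kernel, by exhaustion: [p_K] is nondecreasing in [K], so the
    supremum over all finite [K] is the limit along any exhaustion of [V] by
    finite sets. *)
Definition heat_kernel (t : R) (x y : V) : \bar R :=
  ereal_sup [set (dirichlet_heat_kernel K t x y)%:E
            | K in [set K : set V | finite_set K]].

(** Integral over [V] of a nonnegative function. *)
Definition vint (g : V -> \bar R) : \bar R :=
  (\esum_(x in [set: V]) (g x * (mu x)%:E))%E.

Definition stochastically_complete : Prop :=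
  forall (t : R) (x : V), 0 < t -> vint (fun y => heat_kernel t x y) = 1%E.

Definition frac_weight (s : R) (x y : V) : \bar R :=
  ((s / Gamma (1 - s) * mu x * mu y)%:E *
   \int[lebesgue_measure]_(t in `]0%R, +oo[)
      (heat_kernel t x y * (t `^ (-1 - s))%:E))%E.

(** Values in [[0, +oo]]: the defining series may diverge. *)
Definition frac_grad (s : R) (u : V -> R) (x : V) : \bar R :=
  (((2 * mu x)^-1%:E *
    \esum_(y in [set~ x]) (frac_weight s x y * ((u x - u y) ^+ 2)%:E))
   `^ (2^-1))%E.

(** Only used for [1 <= q]; the value at [-oo] is a dummy. *)
Definition Lq_norm (q : \bar R) (u : V -> R) : \bar R :=
  match q with
  | r%:E => (vint (fun x => (`|u x| `^ r)%:E) `^ r^-1)%E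
  | +oo%E => ereal_sup (range (fun x => `|u x|%:E))
  | -oo%E => 0%E
  end.

Definition Lq (q : \bar R) : set (V -> R) :=
  [set u | (Lq_norm q u < +oo)%E].

Definition finite_support : set (V -> R) :=
  [set u | finite_set [set x | u x != 0]].

Definition sobolev_energy (s p : R) (u : V -> R) : \bar R :=
  vint (fun x => frac_grad s u x `^ p + (`|u x| `^ p)%:E)%E.

Definition sobolev (s p : R) : set (V -> R) :=
  [set u | Lq +oo%E u /\ (sobolev_energy s p u < +oo)%E].

Definition sobolev_norm (s p : R) (u : V -> R) : R :=
  fine (sobolev_energy s p u `^ p^-1)%E.

(** [S], normed by [N], is continuously included in [L^q]. *)
Definition embedded_in_Lq (S : set (V -> R)) (N : (V -> R) -> R)
    (q : \bar R) : Prop :=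
  S `<=` Lq q /\
  exists C : R, forall u, S u -> (Lq_norm q u <= (C * N u)%:E)%E.

End Graph.

Section Reflexivity.
Context {R : realType} (X : normedModType R).

Definition dual : set (X -> R^o) := [set f | linear f /\ continuous f].

Definition dual_norm (f : X -> R^o) : R :=
  sup [set `|f x| | x in [set x : X | `|x| <= 1]].

(** [Phi] stands for an element of the bidual; only its values on [dual]
    matter. *)
Definition bidual (Phi : (X -> R^o) -> R) : Prop :=
  (forall (a : R) (f g : X -> R^o), dual f -> dual g ->
     Phi (fun x => a * f x + g x) = a * Phi f + Phi g) /\
  exists C : R, forall f, dual f -> `|Phi f| <= C * dual_norm f.

(** The canonical map into the bidual is onto. *)
Definition reflexive_space : Prop :=
  forall Phi, bidual Phi -> exists x : X, forall f, dual f -> Phi f = f x.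

End Reflexivity.

(** [S] is a linear subspace of [V -> R] on which [N] is a norm making it a
    reflexive Banach space: [X] is a copy of [S] carrying that structure. *)
Definition reflexive_banach_space {R : realType} {V : Type}
    (S : set (V -> R)) (N : (V -> R) -> R) : Prop :=
  exists (X : completeNormedModType R) (iota : X -> (V -> R^o)),
    [/\ linear iota, injective iota, range iota = S,
        forall v : X, `|v| = N (iota v) & reflexive_space X].

Definition upos {R : realType} {V : Type} (u : V -> R) : V -> R :=
  fun x => Num.max (u x) 0.

(** The negative part is nonpositive here, so [|u| = upos u - uneg u]. *)
Definition uneg {R : realType} {V : Type} (u : V -> R) : V -> R :=
  fun x => Num.min (u x) 0.

(* Main.v *)
From HB Require Import structures.
Require Import Defs.
From mathcomp Require Import measurable_realfun ring lra.

(** Everything rests on two facts.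

    The weights [frac_weight G s x y] with [y != x] have a finite sum.  By
    stochastic completeness the heat kernel started at [x] has total mass [1],
    and comparison with the Dirichlet kernel of the single vertex [x] shows that
    at most [d * t] of it has left [x] at time [t]
    ([heat_kernel_off_diag_le]).  Since [Num.min 1 (d * t)] is integrable against
    [t `^ (-1 - s)], the sum over [y] of the defining integrals converges
    ([frac_weight_sum_le]).  The weights are moreover symmetric, because the
    Dirichlet Laplacian is self-adjoint ([frac_weightC]).  Thus they are real
    numbers, and indicators of points have finite energy ([sobolev_indicator]):
    at [x] the squared gradient [a] of the indicator of [z] is a multiple of the
    weight of [(x, z)] and is bounded, so [a `^ (p / 2)], with [p / 2] at least
    [1], is controlled by [a].

    The energy, the [p]-th power of the norm, is uniformly convex.  It is the
    supremum along an exhaustion of finite sums of [(p / 2)]-th powers of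
    quadratic forms ([sobolev_energy_le]).  Each of these is convex, satisfies
    Clarkson's inequality by the parallelogram law ([fin_energy_clarkson]), is
    monotone under contractions of the values, and is lower semicontinuous for
    pointwise convergence; all four properties pass to the supremum.  Convexity
    and homogeneity give the triangle inequality; lower semicontinuity gives
    completeness, point evaluations being bounded because the measure is bounded
    below.  The last bound also gives the embedding into bounded functions, and
    the other embeddings by interpolation; monotonicity gives stability under
    positive and negative parts.

    Reflexivity is the theorem of Milman and Pettis, in a variational form
    ([clarkson_reflexive]).  Given [Phi] in the bidual, maximise [Phi f] minus the
    Legendre conjugate, at [f], of the [p]-th power of the norm.  By uniform
    convexity this conjugate is differentiable, the derivative at [f] being the
    evaluation at the maximiser [x] of [f x - `|x| `^ p]; at a maximum this
    derivative is [Phi].  The proof works with almost maximisers and shows that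
    the points [x] so obtained form a Cauchy sequence. *)

Set Implicit Arguments.
Unset Strict Implicit.
Unset Printing Implicit Defensive.

(** * Clarkson's inequality implies reflexivity *)

Section MilmanPettis.
Context {R : realType} {X : completeNormedModType R}.
Variable p : R.
Hypothesis p_gt1 : 1 < p.
Hypothesis clarkson : forall x y : X,
  `|2^-1 *: (x + y)| `^ p + `|2^-1 *: (x - y)| `^ p <=
  (`|x| `^ p + `|y| `^ p) / 2.
Implicit Types (f g h : X -> R^o) (x y : X).

Let p_gt0 : 0 < p. Proof. exact: lt_trans p_gt1. Qed.
Let c : R := 2 * 2^-1 `^ p.
Let c_gt0 : 0 < c. Proof. by rewrite /c mulr_gt0// powR_gt0// invr_gt0. Qed.

Lemma dualD f g : dual f -> dual g -> dual (f \+ g).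
Proof.
move=> [lf cf] [lg cg]; split=> [a x y|x].
  by rewrite /= lf lg scalerDr addrACA.
exact: cvgD (cf x) (cg x).
Qed.

Lemma dualZ a f : dual f -> dual (fun x => a *: f x).
Proof.
move=> [lf cf]; split=> [b x y|x].
  by rewrite /= lf scalerDr !scalerA mulrC.
exact: cvgZl_tmp (cf x).
Qed.

Lemma dualB f g : dual f -> dual g -> dual (f \- g).
Proof.
move=> df dg; have := dualD df (dualZ (-1) dg).
by congr dual; apply/funext => x /=; rewrite scaleN1r.
Qed.

Lemma dual_sub f x y : dual f -> f (x - y) = f x - f y.
Proof. by move=> [lf _]; rewrite addrC -scaleN1r lf scaleN1r addrC. Qed.

Lemma dual0 f : dual f -> f 0 = 0.
Proof. by move=> df; rewrite -(subrr (0 : X)) dual_sub// subrr. Qed.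

Lemma dual_add f x y : dual f -> f (x + y) = f x + f y.
Proof. by move=> [lf _]; rewrite -{1}(scale1r x) lf scale1r. Qed.

Lemma dual_scale f a x : dual f -> f (a *: x) = a * f x.
Proof. by move=> df; have [lf _] := df; rewrite -{1}(addr0 (a *: x)) lf dual0// addr0. Qed.

(** Continuity at [0] bounds a functional on a ball, hence on the unit ball by
    homogeneity; so [dual_norm] is a genuine supremum. *)
Lemma dual_has_sup f : dual f ->
  has_sup [set `|f x| | x in [set x : X | `|x| <= 1]].
Proof.
move=> df; split; first by exists `|f 0|, 0 => //=; rewrite normr0.
have [_ /(_ 0)] := df; rewrite /continuous_at (dual0 df).
move=> /cvgr0_norm_lt/(_ _ ltr01)/nbhs_ballP[d /= d0 dP].
exists (2 / d) => _ [x /= x1 <-].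
have /= := dP ((d / 2) *: x).
rewrite -ball_normE /= sub0r normrN normrZ gtr0_norm ?divr_gt0//.
have -> : d / 2 * `|x| < d by nra.
move=> /(_ isT); rewrite dual_scale// normrM gtr0_norm ?divr_gt0// => fx.
rewrite ler_pdivlMr//; nra.
Qed.

Lemma dual_norm_ge0 f : dual f -> 0 <= dual_norm f.
Proof.
move=> df; have [_ ub] := dual_has_sup df.
apply: le_trans (normr_ge0 (f 0)) _; apply: ub_le_sup => //.
by exists 0 => //=; rewrite normr0.
Qed.

Lemma dual_bound f x : dual f -> `|f x| <= dual_norm f * `|x|.
Proof.
move=> df; have [->|x0] := eqVneq x 0.
  by rewrite dual0// !normr0 mulr0.
have nx0 : 0 < `|x| by rewrite normr_gt0.
have [_ ub] := dual_has_sup df.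
rewrite -ler_pdivrMr//; apply: ub_le_sup => //.
exists (`|x|^-1 *: x) => /=.
  by rewrite normrZ normfV normr_id mulVf ?gt_eqF.
by rewrite dual_scale// normrM normfV normr_id mulrC.
Qed.

Lemma dual_norm_le f K : dual f ->
  (forall x, `|x| <= 1 -> `|f x| <= K) -> dual_norm f <= K.
Proof.
move=> df fK; have [ne _] := dual_has_sup df.
by apply: ge_sup => // _ [x x1 <-]; exact: fK.
Qed.

(** The Legendre conjugate of the [p]-th power of the norm. *)
Definition power_conj f := sup [set f x - `|x| `^ p | x in [set: X]].

(** [`|x| `^ p] outgrows every multiple of [`|x|] because [1 < p]. *)
Lemma power_conj_has_sup f : dual f ->
  has_sup [set f x - `|x| `^ p | x in [set: X]].
Proof.
move=> df; split; first by exists (f 0 - `|0 : X| `^ p), 0.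
set D := dual_norm f; have D0 : 0 <= D by exact: dual_norm_ge0.
exists (D * D `^ (p - 1)^-1) => _ [x _ <-].
have := dual_bound x df; rewrite -/D => fx.
have {fx} fx : f x <= D * `|x| by rewrite (le_trans (ler_norm _)).
have [xD|Dx] := leP `|x| (D `^ (p - 1)^-1).
  by rewrite lerBlDr (le_trans fx)// -[leLHS]addr0 lerD ?powR_ge0// ler_wpM2l.
rewrite lerBlDr (le_trans fx)//.
have : D <= `|x| `^ (p - 1).
  have -> : D = (D `^ (p - 1)^-1) `^ (p - 1).
    by rewrite -powRrM mulVf ?powRr1// gt_eqF ?subr_gt0.
  by apply: ge0_ler_powR; rewrite ?nnegrE ?powR_ge0 ?subr_ge0 ?normr_ge0 ?ltW.
rewrite -(mulr_powRB1 (normr_ge0 x) p_gt0) => Dx'.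
have D1 : 0 <= D `^ (p - 1)^-1 by exact: powR_ge0.
have := normr_ge0 x; nra.
Qed.

Lemma power_conj_ge f x : dual f -> f x - `|x| `^ p <= power_conj f.
Proof. by move=> /power_conj_has_sup[_ ub]; apply: ub_le_sup => //; exists x. Qed.

Lemma power_conj_le f K : (forall x, f x - `|x| `^ p <= K) -> power_conj f <= K.
Proof.
move=> fK; apply: ge_sup; last by move=> _ [x _ <-].
by exists (f 0 - `|0 : X| `^ p), 0.
Qed.

Lemma power_conj_near f e : dual f -> 0 < e ->
  exists x, power_conj f - e <= f x - `|x| `^ p.
Proof.
move=> /power_conj_has_sup hs e0; have [_ [x _ <-] xe] := sup_adherent e0 hs.
by exists x; exact: ltW.
Qed.

(** Testing the supremum on the ball of radius [r]; as [r] is arbitrary, the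
    conjugate grows faster than any multiple of the dual norm. *)
Lemma power_conj_coercive f r : dual f -> 0 < r ->
  r * dual_norm f <= power_conj f + r `^ p.
Proof.
move=> df r0; rewrite mulrC -ler_pdivlMr//; apply: dual_norm_le => // x x1.
rewrite ler_pdivlMr// -lerBlDr.
wlog fx0 : x x1 / 0 <= f x => [H|].
  have [|/ltW fx0] := leP 0 (f x); first exact: H.
  have := H (- x); rewrite normrN -(scaleN1r x) dual_scale// mulN1r normrN.
  by apply => //; rewrite oppr_ge0.
rewrite ger0_norm//; have := power_conj_ge (r *: x) df.
apply: le_trans; rewrite dual_scale// mulrC lerB//.
apply: ge0_ler_powR; rewrite ?nnegrE ?(ltW r0)// ?(ltW p_gt0)//.
by rewrite normrZ gtr0_norm// ler_piMr// ltW.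
Qed.

(** The midpoint of [x] and [y] cannot beat the supremum, and Clarkson's
    inequality at that midpoint yields a gain of order [`|y - x| `^ p]: almost
    maximisers are well separated from everything else. *)
Lemma near_max_growth f e x y : dual f -> power_conj f - e <= f x - `|x| `^ p ->
  f y - `|y| `^ p + c * `|y - x| `^ p <= f x - `|x| `^ p + 2 * e.
Proof.
move=> df xe; have := power_conj_ge (2^-1 *: (y + x)) df.
rewrite dual_scale// dual_add// => m.
have := clarkson y x; rewrite [X in _ + X <= _ -> _](_ : _ = c * `|y - x| `^ p / 2); last first.
  by rewrite normrZ powRM// (ger0_norm (_ : 0 <= 2^-1))// /c; field.
lra.
Qed.

(** The conjugate is smooth, with derivative an almost maximiser [x]: the
    growth term of [near_max_growth] absorbs [h (y - x)] as soon as
    [`|y - x|] exceeds [eta]. *)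
Lemma power_conj_smooth f h e eta x : dual f -> dual h -> 0 < eta ->
  power_conj f - e <= f x - `|x| `^ p -> dual_norm h <= c * eta `^ (p - 1) ->
  power_conj (f \+ h) <= power_conj f + 2 * e + h x + dual_norm h * eta.
Proof.
move=> df dh eta0 xe hh; apply: power_conj_le => y /=.
have := near_max_growth y df xe; have := power_conj_ge x df.
have -> : h y = h x + h (y - x) by rewrite dual_sub// subrKC.
have : h (y - x) <= dual_norm h * eta + c * `|y - x| `^ p.
  have hyx := le_trans (ler_norm _) (dual_bound (y - x) dh).
  have D0 := dual_norm_ge0 dh.
  have [yx|yx] := leP `|y - x| eta.
    rewrite (le_trans hyx)// -[leLHS]addr0 lerD//.
      by rewrite ler_wpM2l.
    by rewrite mulr_ge0 ?powR_ge0// ltW.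
  rewrite (le_trans hyx)// -[leLHS]add0r lerD//.
    by rewrite mulr_ge0 // ltW.
  rewrite -(mulr_powRB1 (normr_ge0 _) p_gt0) mulrCA mulrC ler_wpM2l//.
  rewrite (le_trans hh)// ler_wpM2l// ?(ltW c_gt0)//.
  by apply: ge0_ler_powR; rewrite ?nnegrE ?subr_ge0 ?normr_ge0 ?ltW.
lra.
Qed.

Section Bidual.
Variables (Phi : (X -> R^o) -> R) (C : R).
Hypothesis Phi_lin : forall (a : R) f g, dual f -> dual g ->
     Phi (fun x => a * f x + g x) = a * Phi f + Phi g.
Hypothesis Phi_bnd : forall f, dual f -> `|Phi f| <= C * dual_norm f.
Hypothesis C_ge0 : 0 <= C.

Let zero_dual : dual (fun _ : X => 0 : R^o).
Proof.
split; first by move=> a x y /=; rewrite scaler0 addr0.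
by move=> x; exact: cvg_cst.
Qed.

Let Phi0 : Phi (fun=> 0) = 0.
Proof.
have := Phi_lin 1 zero_dual zero_dual; under eq_fun do rewrite mulr0 addr0.
by rewrite mul1r => /eqP; rewrite -subr_eq0 opprD addrA subrr sub0r oppr_eq0 => /eqP.
Qed.

Let PhiZ a f : dual f -> Phi (fun x => a *: f x) = a * Phi f.
Proof.
by move=> df; have := Phi_lin a df zero_dual; under eq_fun do rewrite addr0; rewrite Phi0 addr0.
Qed.

Let PhiD f g : dual f -> dual g -> Phi (f \+ g) = Phi f + Phi g.
Proof.
move=> df dg; have := Phi_lin 1 df dg; rewrite mul1r => <-.
by congr Phi; apply/funext => x; rewrite mul1r.
Qed.

Let B : R := (C + 1) `^ p + 1.

(** By coercivity of the conjugate, [Phi f - power_conj f] is bounded above,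
    and its almost maximisers [f] lie in a fixed ball. *)
Lemma gap_has_sup : has_sup [set Phi f - power_conj f | f in @dual R X].
Proof.
split; first by exists (Phi (fun=> 0) - power_conj (fun=> 0)), (fun=> 0).
exists ((C + 1) `^ p) => _ [f df <-].
have /(power_conj_coercive df) : 0 < C + 1 by rewrite ltr_wpDl.
have := le_trans (ler_norm _) (Phi_bnd df).
have := dual_norm_ge0 df; nra.
Qed.

Lemma gap_near_bounded f e : dual f -> e <= 1 ->
  sup [set Phi f - power_conj f | f in @dual R X] - e <= Phi f - power_conj f ->
  dual_norm f <= B.
Proof.
move=> df e1 fe.
have : 0 <= sup [set Phi f - power_conj f | f in @dual R X].
  apply: (@le_trans _ _ (Phi (fun=> 0) - power_conj (fun=> 0))); last first.
    by apply: ub_le_sup; [have [] := gap_has_sup | exists (fun=> 0)].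
  rewrite Phi0 sub0r oppr_ge0; apply: power_conj_le => x.
  by rewrite sub0r oppr_le0 powR_ge0.
have /(power_conj_coercive df) : 0 < C + 1 by rewrite ltr_wpDl.
have := le_trans (ler_norm _) (Phi_bnd df); rewrite /B.
have := dual_norm_ge0 df; nra.
Qed.

(** Take [f] almost maximising [Phi f - power_conj f] and [x] almost maximising
    the supremum that defines [power_conj f].  At a true maximum the derivative
    of the conjugate at [f], which is evaluation at [x], would be [Phi];
    comparing [f] with [f + t *: g] for a small fixed [t] turns almost
    maximality into an estimate that is uniform in [g]. *)
Lemma almost_evaluation (eta : R) : 0 < eta ->
  exists fx : (X -> R^o) * X, [/\ dual fx.1, dual_norm fx.1 <= B,
    power_conj fx.1 - eta <= fx.1 fx.2 - `|fx.2| `^ p &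
    forall g (K : R), dual g -> 0 < K -> dual_norm g <= K ->
      `|Phi g - g fx.2| <= eta * K].
Proof.
move=> eta0; set S := sup [set Phi f - power_conj f | f in @dual R X].
(* [t] is the largest norm of a perturbation allowed by [power_conj_smooth]. *)
pose t := c * (eta / 2) `^ (p - 1).
have t0 : 0 < t by rewrite mulr_gt0// powR_gt0 ?divr_gt0.
have [e [e0 e1 e2 e3]] : exists e : R, [/\ 0 < e, e <= 1, e <= eta & e <= t * eta / 6].
  exists (Num.min 1 (Num.min eta (t * eta / 6))).
  have te : 0 < t * eta / 6 by rewrite divr_gt0// mulr_gt0.
  by rewrite !lt_min ltr01 eta0 te !ge_min !lexx !orbT.
have [_ [f df <-] fe] := sup_adherent e0 gap_has_sup.
rewrite -/S in fe.
have [x xe] := power_conj_near df e0.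
have key g : dual g -> dual_norm g <= 1 -> Phi g - g x <= eta.
  move=> dg g1; pose h := fun x => t *: g x.
  have dh : dual h by exact: dualZ.
  have nh : dual_norm h <= t.
    apply: dual_norm_le => // y y1; rewrite /h normrM gtr0_norm//.
    rewrite -[leRHS]mulr1 ler_pM2l// (le_trans (dual_bound y dg))//.
    have := dual_norm_ge0 dg; have := normr_ge0 y; nra.
  have : Phi (f \+ h) - power_conj (f \+ h) <= S.
    apply: ub_le_sup; first by have [] := gap_has_sup.
    by exists (f \+ h) => //; exact: dualD.
  rewrite PhiD// PhiZ//.
  have eta20 : 0 < eta / 2 by rewrite divr_gt0.
  have := power_conj_smooth df dh eta20 xe nh.
  rewrite -[h x]/(t * g x).
  have : dual_norm h * (eta / 2) <= t * (eta / 2) by rewrite ler_pM2r.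
  move=> A1 A2 A3.
  rewrite -(ler_pM2l t0); nra.
exists (f, x) => /=; split => //.
- exact: (@gap_near_bounded f e df e1 (ltW fe)).
- by lra.
move=> g K dg K0 gK.
have dn a : `|a| = K^-1 -> dual_norm (fun x => a *: g x) <= 1.
  move=> aK; apply: dual_norm_le; first exact: dualZ.
  move=> y y1; rewrite normrM aK mulrC ler_pdivrMr// mul1r.
  apply: le_trans (dual_bound y dg) _.
  have := dual_norm_ge0 dg; have := normr_ge0 y; nra.
rewrite ler_norml; apply/andP; split.
  have := key _ (dualZ (- K^-1) dg) (dn _ _).
  rewrite normrN gtr0_norm ?invr_gt0// => /(_ erefl); rewrite PhiZ//.
  rewrite -[_ *: _]/(- K^-1 * g x) -mulrBr mulNr -mulrN opprB mulrC.
  by rewrite ler_pdivrMr// lerNl opprB.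
have := key _ (dualZ (K^-1) dg) (dn _ _).
rewrite gtr0_norm ?invr_gt0// => /(_ erefl); rewrite PhiZ//.
by rewrite -[_ *: _]/(K^-1 * g x) -mulrBr mulrC ler_pdivrMr.
Qed.

Let B_gt0 : 0 < B. Proof. by rewrite ltr_wpDl// powR_ge0. Qed.

(** The almost maximisers [x n] are Cauchy: with [fx n = (f n, x n)], adding
    [near_max_growth] for [n] and [m] bounds [`|x n - x m| `^ p] by the value
    of [f n - f m] at [x n - x m], and both [x n] and [x m] represent [Phi] up
    to a small error. *)
Lemma bidual_evaluation : exists x : X, forall f, dual f -> Phi f = f x.
Proof.
have /choice[fx fxP] : forall n : nat, exists fx : (X -> R^o) * X, [/\ dual fx.1, dual_norm fx.1 <= B,
    power_conj fx.1 - n.+1%:R^-1 <= fx.1 fx.2 - `|fx.2| `^ p &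
    forall g (K : R), dual g -> 0 < K -> dual_norm g <= K ->
      `|Phi g - g fx.2| <= n.+1%:R^-1 * K].
  by move=> n; apply: almost_evaluation; rewrite invr_gt0.
pose x n := (fx n).2.
have dist n m : c * `|x n - x m| `^ p <=
    (n.+1%:R^-1 + m.+1%:R^-1) * (B + 1).
  have [dn bn en gn] := fxP n; have [dm bm em gm] := fxP m.
  have := near_max_growth (x m) dn en; have := near_max_growth (x n) dm em.
  rewrite -/(x m) -/(x n) (distrC (x m)).
  have dg : dual ((fx n).1 \- (fx m).1) by exact: dualB.
  have B20 : 0 < 2 * B by rewrite mulr_gt0.
  have ng : dual_norm ((fx n).1 \- (fx m).1) <= 2 * B.
    apply: dual_norm_le => // y y1; rewrite (le_trans (ler_normB _ _))//.
    have := dual_bound y dn; have := dual_bound y dm.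
    have := dual_norm_ge0 dn; have := dual_norm_ge0 dm; have := normr_ge0 y.
    nra.
  have := gn _ _ dg B20 ng; have := gm _ _ dg B20 ng.
  rewrite -/(x m) -/(x n) /= !ler_norml => /andP[u1 u2] /andP[v1 v2].
  move: u2 v1; move: (n.+1%:R^-1) (m.+1%:R^-1) B (`|x n - x m| `^ _) => a b B' P.
  lra.
have cx : cauchy (x @ \oo).
  apply: cauchy_exP => e e0.
  have B1 : 0 < 2 * (B + 1) by rewrite mulr_gt0// ltr_wpDr// ltW.
  have k0 : 0 < c * e `^ p / (2 * (B + 1)).
    by apply: divr_gt0 B1; exact: mulr_gt0 c_gt0 (powR_gt0 _ e0).
  have [N _ NP] := near_infty_natSinv_lt (PosNum k0).
  exists (x N), N => // n /= Nn; rewrite -ball_normE /= ltNge; apply/negP => ex.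
  have := NP _ Nn; have := NP _ (leqnn N); rewrite /= !(ltr_pdivlMr _ _ B1).
  have := dist N n.
  have : e `^ p <= `|x N - x n| `^ p.
    by apply: ge0_ler_powR; rewrite ?nnegrE ?(ltW p_gt0)// ltW.
  rewrite -(ler_pM2l c_gt0).
  move: (c * _) (c * _) (N.+1%:R^-1) (n.+1%:R^-1) B => P Q a b B'.
  lra.
have /cauchy_cvg/cvg_ex[l xl] := cx.
exists l => f df; apply/eqP; rewrite -subr_eq0 -normr_le0.
have K0 : 0 < dual_norm f + 1 by rewrite ltr_wpDl// dual_norm_ge0.
have fxl : f (x n) @[n --> \oo] --> f l.
  by apply: continuous_cvg => //; have [_] := df; exact.
have l1 : (`|Phi f - f (x n)| : R^o) @[n --> \oo] --> (`|Phi f - f l| : R^o).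
  by apply: cvg_norm; apply: cvgB => //; exact: cvg_cst.
have l2 : n.+1%:R^-1 * (dual_norm f + 1) @[n --> \oo] --> (0 * (dual_norm f + 1) : R).
  by apply: cvgM; [exact: cvg_harmonic|exact: cvg_cst].
rewrite -[leRHS](mul0r (dual_norm f + 1)); apply: ler_cvg_to l1 l2 _.
near=> n; have [_ _ _] := fxP n; apply => //.
by rewrite lerDl.
Unshelve. all: by end_near. Qed.

End Bidual.

Theorem clarkson_reflexive : reflexive_space X.
Proof.
move=> Phi [lin [C bnd]].
apply: (@bidual_evaluation Phi `|C|) => // f df.
apply: le_trans (bnd _ df) _; apply: ler_wpM2r; first exact: dual_norm_ge0.
exact: ler_norm.
Qed.

End MilmanPettis.

(** * Function spaces defined by a uniformly convex energy *)

Section EnergySpace.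
Context {R : realType} {V : eqType}.
Variable p : R.

(** [energy_lsc] is lower semicontinuity for pointwise convergence, phrased
    with finite sets of points so as to apply to filters as well as to
    sequences. *)
Record clarkson_energy (S : set (V -> R)) (E : (V -> R) -> R) : Prop := {
  energy_dom0 : S (fun=> 0);
  energy_domP : forall a u v, S u -> S v -> S (fun x => a * u x + v x);
  energy_ge0 : forall u, 0 <= E u;
  energyZ : forall a u, S u -> E (fun x => a * u x) = `|a| `^ p * E u;
  energy_convex : forall t u v, 0 <= t <= 1 -> S u -> S v ->
    E (fun x => t * u x + (1 - t) * v x) <= t * E u + (1 - t) * E v;
  energy_clarkson : forall u v, S u -> S v ->
    E (fun x => 2^-1 * (u x + v x)) + E (fun x => 2^-1 * (u x - v x)) <=
    (E u + E v) / 2;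
  energy_eval : forall x, exists K, forall u, S u ->
    `|u x| <= K * E u `^ p^-1;
  energy_lsc : forall u M,
    (forall (xs : seq V) (d : R), 0 < d ->
      exists v, [/\ S v, E v <= M & forall x, x \in xs -> `|v x - u x| <= d]) ->
    S u /\ E u <= M }.

Hypothesis p_gt1 : 1 < p.
Let p_gt0 : 0 < p. Proof. exact: lt_trans p_gt1. Qed.

Section Carrier.
Context {S : set (V -> R)} {E : (V -> R) -> R}.

(** The proof [SE] is a parameter so that the canonical structures, which
    depend on it, can be attached to the type. *)
Record energy_space (SE : clarkson_energy S E) := EnergySpace {
  energy_fun : V -> R^o;
  energy_funP : `[< S energy_fun >] }.

Variable SE : clarkson_energy S E.
Local Notation X := (energy_space SE).

HB.instance Definition _ := [isSub for @energy_fun SE].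
HB.instance Definition _ := [Choice of X by <:].

Lemma energy_submod_closed :
  @subsemimod_closed R (V -> R^o) (fun u => `[< S u >]).
Proof.
split.
  split; first by apply/asboolP; exact: (energy_dom0 SE).
  move=> u v /asboolP Su /asboolP Sv; apply/asboolP.
  have := energy_domP SE 1 Su Sv; congr S.
  by apply/funext => x; rewrite mul1r.
move=> a u /asboolP Su; apply/asboolP.
have := energy_domP SE a Su (energy_dom0 SE); congr S.
by apply/funext => x; rewrite addr0.
Qed.

HB.instance Definition _ :=
  GRing.SubChoice_isSubLmodule.Build R (V -> R^o) (fun u => `[< S u >]) X
    energy_submod_closed.

Lemma energy_funS (u : X) : S (energy_fun u).
Proof. exact/asboolP/energy_funP. Qed.
#[local] Hint Resolve energy_funS : core.

Lemma energy_funD (u v : X) : energy_fun (u + v) = fun x => energy_fun u x + energy_fun v x.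
Proof. by []. Qed.
Lemma energy_funZ a (u : X) : energy_fun (a *: u) = fun x => a * energy_fun u x.
Proof. by []. Qed.
Lemma energy_funB (u v : X) : energy_fun (u - v) = fun x => energy_fun u x - energy_fun v x.
Proof. by []. Qed.

Definition enorm (u : V -> R) : R := E u `^ p^-1.

Lemma enorm_powR u : enorm u `^ p = E u.
Proof.
by rewrite /enorm -powRrM mulVf ?gt_eqF// powRr1// (energy_ge0 SE).
Qed.

Lemma enorm_le u r : 0 <= r -> (enorm u <= r) = (E u <= r `^ p).
Proof.
move=> r0; rewrite -enorm_powR; apply/idP/idP => [ur|].
  by apply: ge0_ler_powR; rewrite ?nnegrE ?powR_ge0// ltW.
apply: contra_le => ru; apply: gt0_ltr_powR; rewrite ?nnegrE ?powR_ge0//.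
Qed.

Lemma enormZ a u : S u -> enorm (fun x => a * u x) = `|a| * enorm u.
Proof.
move=> Su; rewrite /enorm (energyZ SE)// powRM ?powR_ge0 ?(energy_ge0 SE)//.
by rewrite -powRrM mulfV ?gt_eqF// powRr1.
Qed.

(** Convexity of [E] makes the unit ball of [enorm] convex, and a homogeneous
    function with convex unit ball is subadditive.  The norms are enlarged by
    [e / 2] to allow for division. *)
Lemma enormD u v : S u -> S v ->
  enorm (fun x => u x + v x) <= enorm u + enorm v.
Proof.
move=> Su Sv; apply/ler_addgt0Pr => e e0.
have one_powR : (1 : R) `^ p = 1 by rewrite powR1.
have unitE w (r : R) : S w -> 0 < r -> enorm w < r ->
    S (fun x => r^-1 * w x) /\ E (fun x => r^-1 * w x) <= 1.
  move=> Sw r0 wr; split.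
    have := energy_domP SE r^-1 Sw (energy_dom0 SE); congr S.
    by apply/funext => x; rewrite addr0.
  rewrite -[leRHS]one_powR -enorm_le// enormZ// ger0_norm ?invr_ge0 ?(ltW r0)//.
  by rewrite mulrC ler_pdivrMr// mul1r ltW.
have N0 w : 0 <= enorm w by exact: powR_ge0.
set a := enorm u + e / 2; set b := enorm v + e / 2.
have a0 : 0 < a by rewrite ltr_wpDl// divr_gt0.
have b0 : 0 < b by rewrite ltr_wpDl// divr_gt0.
have -> : enorm u + enorm v + e = a + b by rewrite /a /b; lra.
have ua : enorm u < a by rewrite ltrDl divr_gt0.
have vb : enorm v < b by rewrite ltrDl divr_gt0.
have [Su1 u1] := unitE u a Su a0 ua; have [Sv1 v1] := unitE v b Sv b0 vb.
have ab0 : 0 < a + b by rewrite addr_gt0.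
pose t := a / (a + b).
have t01 : 0 <= t <= 1.
  by rewrite divr_ge0 ?(ltW a0) ?(ltW ab0)//= ler_pdivrMr// mul1r lerDl ltW.
have t1 : 1 - t = b / (a + b) by rewrite /t; field; rewrite gt_eqF.
have := energy_convex SE t01 Su1 Sv1.
set w := (fun x => _ + _) => Ew.
have Sw : S w.
  rewrite /w; have := energy_domP SE t Su1 (energy_domP SE (1 - t) Sv1 (energy_dom0 SE)).
  by congr S; apply/funext => x; rewrite addr0.
have -> : (fun x => u x + v x) = fun x => (a + b) * w x.
  apply/funext => x; rewrite /w t1 /t; field.
  by rewrite !gt_eqF.
rewrite enormZ// gtr0_norm// ler_piMr ?(ltW ab0)// enorm_le// one_powR.
apply: le_trans Ew _; have /andP[t0 t2] := t01; nra.
Qed.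

Lemma enorm_eq0 u : S u -> enorm u = 0 -> u = fun=> 0.
Proof.
move=> Su u0; apply/funext => x; have [K KP] := energy_eval SE x.
by apply/eqP; rewrite -normr_le0 (le_trans (KP _ Su))// -/(enorm u) u0 mulr0.
Qed.

Let nrm (u : X) : R := enorm (energy_fun u).

Let nrmD u v : nrm (u + v) <= nrm u + nrm v.
Proof. by rewrite /nrm energy_funD enormD. Qed.

Let nrmZ a u : nrm (a *: u) = `|a| * nrm u.
Proof. by rewrite /nrm energy_funZ enormZ. Qed.

Let nrm_eq0 u : nrm u = 0 -> u = 0.
Proof.
by move=> /(enorm_eq0 (energy_funS u)) u0; apply: val_inj.
Qed.

HB.instance Definition _ := Lmodule_isNormed.Build R X nrmD nrmZ nrm_eq0.

Lemma energy_normE (u : X) : `|u| = enorm (energy_fun u). Proof. by []. Qed.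

(** A Cauchy filter converges pointwise because evaluations are bounded, and
    lower semicontinuity passes the Cauchy estimate to the pointwise limit. *)
Lemma energy_complete (F : set_system X) : ProperFilter F -> cauchy F -> cvg F.
Proof.
move=> FF /cauchyP Fc.
have ev_cauchy x : cvg ((fun u : X => energy_fun u x : R^o) @ F).
  apply: cauchy_cvg; apply/cauchy_exP => e e0; have [K KP] := energy_eval SE x.
  have K1 : 0 < `|K| + 1 by rewrite ltr_wpDl.
  have [w wP] := Fc (e / (`|K| + 1)) (divr_gt0 e0 K1).
  exists (energy_fun w x); rewrite /fmap /=; apply: filterS wP => u.
  rewrite -!ball_normE /= energy_normE energy_funB ltr_pdivlMr// => wu.
  have /KP := energy_funS (w - u); rewrite energy_funB -/(enorm _).
  move=> /le_lt_trans; apply; apply: le_lt_trans wu.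
  rewrite mulrC ler_wpM2l ?powR_ge0//.
  by rewrite (le_trans (ler_norm K))// lerDl.
pose u x : R := lim ((fun u : X => energy_fun u x : R^o) @ F).
have near w e : 0 < e -> F (ball w e) ->
    S (fun x => u x - energy_fun w x) /\
    enorm (fun x => u x - energy_fun w x) <= e.
  move=> e0 Fw; rewrite enorm_le ?(ltW e0)//; apply: (energy_lsc SE) => xs d d0.
  have Fxs : F [set v : X | forall x, x \in xs -> `|energy_fun v x - u x| <= d].
    elim: xs => [|x xs IH]; first by apply: filterS filterT.
    have /cvgrPdist_le/(_ _ d0) Fx := ev_cauchy x.
    apply: filterS2 IH Fx => v vxs vx y; rewrite inE => /orP[/eqP ->|]; last exact: vxs.
    by rewrite distrC.
  have [v [wv vxs]] := filter_ex (filterI Fw Fxs).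
  exists (fun x => energy_fun v x - energy_fun w x); split.
  - by rewrite -energy_funB.
  - rewrite -energy_funB -enorm_le ?(ltW e0)// -energy_normE distrC.
    by move: wv; rewrite -ball_normE => /ltW.
  - by move=> x /vxs; rewrite opprB addrA subrK.
have Su : S u.
  have [w /(near _ _ ltr01)[Su _]] := Fc 1 ltr01.
  have := energy_domP SE 1 Su (energy_funS w); congr S.
  by apply/funext => x; rewrite mul1r subrK.
pose U : X := EnergySpace SE (asboolT Su).
apply/cvg_ex; exists U; apply/cvgrPdist_le => e e0.
have e20 : 0 < e / 2 by rewrite divr_gt0.
have [w wF] := Fc _ e20.
have [_ Uw] := near _ _ e20 wF.
apply: filterS wF => v; rewrite -ball_normE /= => wv.
rewrite (splitr e) -(subrK w U) -addrA (le_trans (ler_normD _ _))// lerD ?(ltW wv)//.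
Qed.

HB.instance Definition _ := Uniform_isComplete.Build X energy_complete.

End Carrier.

Theorem energy_reflexive_banach S E : clarkson_energy S E ->
  reflexive_banach_space S (fun u => E u `^ p^-1).
Proof.
move=> SE; exists (energy_space SE), (@energy_fun _ _ SE); split => //.
- exact: val_inj.
- apply/seteqP; split => [_ [u _ <-]|u Su]; first exact: energy_funS.
  by exists (EnergySpace SE (asboolT Su)).
- apply: (@clarkson_reflexive R (energy_space SE) p) => // u v.
  rewrite !energy_normE !(enorm_powR SE) !energy_funZ energy_funD energy_funB.
  by apply: (energy_clarkson SE); exact: energy_funS.
Qed.

End EnergySpace.

(** * Symmetry of the heat kernel and its bound on the diagonal *)

Section HeatKernel.
Context {R : realType} {V : countType}.
Variable G : weighted_graph R V.
Hypothesis Glf : locally_finite G.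
Local Notation mu := (vmeas G).

Lemma vmeas_neq0 x : mu x != 0.
Proof. by rewrite gt_eqF ?vmeas_gt0. Qed.
#[local] Hint Resolve vmeas_neq0 : core.

Section Dirichlet.
Variable K : set V.
Hypothesis K_fin : finite_set K.
Local Notation L := (dirichlet_laplacian G K).

Let a x z : R := if edge G x z then weight G x z else 0.
Let deg x : R := \sum_(y \in [set y | edge G x y]) weight G x y.

Let a_sym x z : a x z = a z x.
Proof.
by rewrite /a edge_sym; case: ifP => // zx; rewrite weight_sym// edge_sym.
Qed.

Let dirichlet_laplacian_matrix u x : K x ->
  mu x * L u x = \sum_(z \in K) a x z * u z - deg x * u x.
Proof.
move=> Kx; rewrite /dirichlet_laplacian /laplacian indicE mem_set// mul1r.
rewrite mulrA mulfV// mul1r mul1r.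
have -> : \sum_(z \in K) a x z * u z =
    \sum_(z \in [set y | edge G x y]) weight G x z * (\1_K z * u z).
  rewrite fsbig_mkcond [RHS]fsbig_mkcond; apply: eq_fsbigr => z _.
  have -> : patch (fun=> 0) [set y | edge G x y]
      (fun i => weight G x i * (\1_K i * u i)) z = a x z * (\1_K z * u z).
    rewrite patchE /a (_ : (z \in _) = edge G x z); last by apply/idP/idP; rewrite inE.
    by case: ifP; rewrite ?mul0r.
  by rewrite patchE indicE; case: (z \in K); rewrite ?mul1r ?mul0r ?mulr0.
rewrite -mulrN /deg mulrC mulr_fsumr -fsbig_split//.
  by apply: eq_fsbigr => z _ /=; rewrite mulrBr mulNr mulrC (mulrC (weight G x z) (u x)).
Qed.

Let dirichlet_laplacian_adjoint u v :
  \sum_(x \in K) mu x * L u x * v x = \sum_(x \in K) mu x * u x * L v x.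
Proof.
transitivity (\sum_(x \in K) (\sum_(z \in K) a x z * u z * v x + - (deg x * u x * v x))).
  apply: eq_fsbigr => x /set_mem Kx; rewrite dirichlet_laplacian_matrix// mulrBl.
  by rewrite [in LHS]mulrC mulr_fsumr; congr (_ - _); apply: eq_fsbigr => z _; rewrite mulrC.
transitivity (\sum_(x \in K) (\sum_(z \in K) a x z * v z * u x + - (deg x * v x * u x))); last first.
  apply: eq_fsbigr => x /set_mem Kx; rewrite [RHS]mulrAC dirichlet_laplacian_matrix// mulrBl.
  by rewrite [in RHS]mulrC mulr_fsumr; congr (_ - _); apply: eq_fsbigr => z _; rewrite mulrC.
rewrite !fsbig_split//; congr (_ + _); last by apply: eq_fsbigr => x _; rewrite mulrAC.
rewrite exchange_fsbig//; apply: eq_fsbigr => x _; apply: eq_fsbigr => z _.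
by rewrite a_sym mulrAC.
Qed.

Let iter_adjoint n u v :
  \sum_(x \in K) mu x * iter n L u x * v x =
  \sum_(x \in K) mu x * u x * iter n L v x.
Proof.
elim: n u v => [//|n IH] u v.
by rewrite iterS dirichlet_laplacian_adjoint IH -iterSr.
Qed.

Let unit_mass y : V -> R := fun z => \1_(K `&` [set y]) z / mu y.

Let sum_unit_mass x (F : V -> R) : K x ->
  \sum_(z \in K) mu z * F z * unit_mass x z = F x.
Proof.
move=> Kx; rewrite -(@fsbig_widen _ _ _ _ [set x]).
- rewrite fsbig_set1 /unit_mass indicE mem_set// mul1r.
  by rewrite mulrAC mulfV// mul1r.
- by move=> z ->.
- move=> z [Kz /= zx]; rewrite /unit_mass indicE memNset ?mul0r ?mulr0//.
  by case.
Qed.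

Let iter_out n u x : ~ K x -> u x = 0 -> iter n L u x = 0.
Proof.
by case: n => // n Kx _; rewrite iterS /dirichlet_laplacian indicE memNset// mul0r.
Qed.

Let iter_zero n x : iter n L (fun=> 0) x = 0.
Proof.
elim: n x => // n IH x; rewrite iterS.
have -> : iter n L (fun=> 0) = fun=> 0 by apply/funext.
rewrite /dirichlet_laplacian /laplacian fsbig1 ?mulr0// => z _.
by rewrite !mulr0 subrr mulr0.
Qed.

Let unit_mass_out y : ~ K y -> unit_mass y = fun=> 0.
Proof.
move=> Ky; apply/funext => z; rewrite /unit_mass indicE memNset ?mul0r//.
by case=> Kz zy; apply: Ky; rewrite -zy.
Qed.

(** Each coefficient of the exponential series is symmetric, because the
    Dirichlet Laplacian is self-adjoint for [mu] and the coefficient at [(x, y)]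
    is its power tested against the unit masses at [x] and [y]. *)
Lemma dirichlet_heat_kernelC t x y :
  dirichlet_heat_kernel G K t x y = dirichlet_heat_kernel G K t y x.
Proof.
rewrite /dirichlet_heat_kernel; congr (limn (series _)); apply/funext => n.
congr (_ * _); rewrite -/(unit_mass x) -/(unit_mass y).
have [Kx|Kx] := pselect (K x); last first.
  rewrite (unit_mass_out Kx) iter_zero iter_out// /unit_mass indicE memNset ?mul0r//.
  by case.
have [Ky|Ky] := pselect (K y); last first.
  rewrite (unit_mass_out Ky) iter_zero iter_out// /unit_mass indicE memNset ?mul0r//.
  by case.
rewrite -(sum_unit_mass _ Kx) iter_adjoint -[RHS](sum_unit_mass _ Ky).
by apply: eq_fsbigr => z _; rewrite mulrAC.
Qed.

End Dirichlet.

Lemma heat_kernelC t x y : heat_kernel G t x y = heat_kernel G t y x.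
Proof.
rewrite /heat_kernel; congr ereal_sup; apply: eq_imagel => K K_fin.
by rewrite dirichlet_heat_kernelC.
Qed.

Lemma frac_weightC s x y : frac_weight G s x y = frac_weight G s y x.
Proof.
rewrite /frac_weight mulrAC; congr (_ * _)%E.
by apply: eq_integral => t _; rewrite heat_kernelC.
Qed.

(** The Dirichlet kernel of the empty set vanishes and takes part in the
    supremum. *)
Lemma heat_kernel_ge0 t x y : (0 <= heat_kernel G t x y)%E.
Proof.
apply: ereal_sup_ubound; exists set0; first exact: finite_set0.
rewrite /dirichlet_heat_kernel; congr EFin; apply: cvg_lim => //.
rewrite (_ : series _ = (fun=> 0)); first exact: cvg_cst.
apply/funext => n; rewrite /series /= big1// => -[|i] _.
  by rewrite /= set0I indicE memNset// mul0r mulr0.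
by rewrite iterS /dirichlet_laplacian indicE memNset// mul0r mulr0.
Qed.

Lemma laplacianZ c u x :
  laplacian G (fun z => c * u z) x = c * laplacian G u x.
Proof.
rewrite /laplacian [RHS]mulrCA; congr (_ * _).
rewrite mulr_fsumr; apply: eq_fsbigr => y _.
by rewrite -mulrBr mulrCA.
Qed.

(** Functions supported at [x] form a line, on which the Dirichlet Laplacian
    acts as a scalar. *)
Lemma dirichlet_heat_kernel1 t x :
  dirichlet_heat_kernel G [set x] t x x =
  expR (t * laplacian G \1_[set x] x) / mu x.
Proof.
set d := laplacian G \1_[set x] x.
have iterE n : iter n (dirichlet_laplacian G [set x])
    (fun z => \1_([set x] `&` [set x]) z / mu x) =
    fun z => d ^+ n / mu x * \1_[set x] z.
  elim: n => [|n IH]; apply/funext => z.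
    by rewrite /= setIid expr0 mul1r mulrC.
  rewrite iterS IH /dirichlet_laplacian mulrC.
  have [->|zx] := eqVneq z x; last by rewrite indicE memNset ?mulr0//=; exact/eqP.
  congr (_ * _); rewrite exprS -mulrA [RHS]mulrC -laplacianZ; congr laplacian.
  apply/funext => y; rewrite mulrCA; congr (_ * _).
  by rewrite indicE; case: (y \in _); rewrite /= ?mulr1 ?mulr0.
clearbody d; rewrite /dirichlet_heat_kernel; apply: cvg_lim => //.
rewrite (_ : series _ = fun n => series (exp_coeff (t * d)) n / mu x); last first.
  apply/funext => n; rewrite /series /= mulr_suml; apply: eq_bigr => i _.
  rewrite iterE indicE mem_set// mulr1 /exp_coeff /= exprMn mulrA; congr (_ / _).
  by rewrite mulrAC.
by apply: cvgMr_tmp; exact: is_cvg_series_exp_coeff.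
Qed.

Lemma heat_kernel_diag_ge t x : (((1 + t * laplacian G \1_[set x] x) / mu x)%:E <=
  heat_kernel G t x x)%E.
Proof.
apply: ereal_sup_ge; exists (dirichlet_heat_kernel G [set x] t x x)%:E.
  by exists [set x] => //; exact: finite_set1.
by rewrite dirichlet_heat_kernel1 lee_fin ler_wpM2r ?expR_ge1Dx// invr_ge0 ltW ?vmeas_gt0.
Qed.

End HeatKernel.

(** * Integrals of nonnegative functions without measurability *)

(** The integral of a nonnegative function is a supremum over the simple
    functions below it.  Hence the inequalities below hold for arbitrary
    functions, such as the heat kernel in its time variable. *)

Section IntegralMonotone.
Import HBNNSimple.
Context d (T : measurableType d) (R : realType) (m : {measure set T -> \bar R}).
Local Open Scope ereal_scope.
Implicit Types (D : set T) (f g : T -> \bar R).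

Lemma nonneg_le_integral D f g :
  (forall x, D x -> 0 <= f x) -> (forall x, D x -> f x <= g x) ->
  \int[m]_(x in D) f x <= \int[m]_(x in D) g x.
Proof.
move=> f0 fg; have g0 x : D x -> 0 <= g x by move=> Dx; exact: le_trans (f0 x Dx) (fg x Dx).
rewrite !ge0_integralE//; apply: le_ereal_sup => _ [h hf <-]; exists h => // x.
apply: le_trans (hf x) _; rewrite !patchE; case: ifP => // /set_mem; exact: fg.
Qed.

Lemma nonneg_integral_superadd D f g :
  (forall x, D x -> 0 <= f x) -> (forall x, D x -> 0 <= g x) ->
  \int[m]_(x in D) f x + \int[m]_(x in D) g x <= \int[m]_(x in D) (f x + g x).
Proof.
move=> f0 g0; have fg0 x : D x -> 0 <= f x + g x by move=> Dx; rewrite adde_ge0 ?f0 ?g0.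
have [->|Mfin] := eqVneq (\int[m]_(x in D) (f x + g x)) +oo; first by rewrite leey.
have {}Mfin : \int[m]_(x in D) (f x + g x) \is a fin_num.
  by rewrite ge0_fin_numE ?integral_ge0// ltey.
have gM : \int[m]_(x in D) g x <= \int[m]_(x in D) (f x + g x).
  by apply: nonneg_le_integral => // x Dx; rewrite leeDr ?f0.
have gfin : \int[m]_(x in D) g x \is a fin_num.
  by rewrite ge0_fin_numE ?integral_ge0// (le_lt_trans gM)// ltey_eq Mfin.
rewrite -leeBrDr//; rewrite [leLHS]ge0_integralE//.
apply: ge_ereal_sup => _ [h1 h1f <-].
have h1M : sintegral m h1 <= \int[m]_(x in D) (f x + g x).
  apply: (@le_trans _ _ (\int[m]_(x in D) f x)).
    by rewrite ge0_integralE//; apply: ereal_sup_ubound; exists h1.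
  by apply: nonneg_le_integral => // x Dx; rewrite leeDl ?g0.
have h1fin : sintegral m h1 \is a fin_num.
  by rewrite ge0_fin_numE ?sintegral_ge0// (le_lt_trans h1M)// ltey_eq Mfin.
rewrite leeBrDr// addeC -leeBrDr//; rewrite [leLHS]ge0_integralE//.
apply: ge_ereal_sup => _ [h2 h2g <-].
rewrite leeBrDr// addeC -sintegralD ge0_integralE//.
apply: ereal_sup_ubound; exists (add_nnsfun h1 h2) => //= x.
rewrite EFinD; apply: (le_trans (leeD (h1f x) (h2g x))).
by rewrite !patchE; case: ifP; rewrite ?adde0.
Qed.

Lemma nonneg_integral_sum_le (I : Type) (s : seq I) D (f : I -> T -> \bar R) :
  (forall i x, D x -> 0 <= f i x) ->
  \sum_(i <- s) \int[m]_(x in D) f i x <= \int[m]_(x in D) \sum_(i <- s) f i x.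
Proof.
move=> f0; elim: s => [|i s IH].
  by rewrite big_nil; apply: integral_ge0 => x _; rewrite big_nil.
under [leRHS]eq_integral do rewrite big_cons.
rewrite big_cons; apply: le_trans (nonneg_integral_superadd _ _); last 2 first.
- by move=> x; exact: f0.
- by move=> x Dx; apply: sume_ge0 => j _; exact: f0.
exact: leeD.
Qed.

Lemma nonneg_integralZl_ge (k : R) D f : (0 <= k)%R ->
  (forall x, D x -> 0 <= f x) ->
  k%:E * \int[m]_(x in D) f x <= \int[m]_(x in D) (k%:E * f x).
Proof.
rewrite le_eqVlt => /predU1P[<- f0|k0 f0].
  by rewrite mul0e integral_ge0// => x _; rewrite mul0e.
have kf0 x : D x -> 0 <= k%:E * f x.
  by move=> Dx; rewrite mule_ge0 ?f0// lee_fin ltW.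
rewrite -lee_pdivlMl// [leLHS]ge0_integralE//; apply: ge_ereal_sup => _ [h hf <-].
rewrite lee_pdivlMl// -sintegralrM ge0_integralE//; apply: ereal_sup_ubound.
exists (scale_nnsfun h (ltW k0)) => //= x.
rewrite patchE; case: ifPn => xD; rewrite EFinM.
  by rewrite lee_wpmul2l ?lee_fin ?(ltW k0)//; have := hf x; rewrite patchE xD.
by rewrite mule_ge0_le0 ?lee_fin ?(ltW k0)//; have := hf x; rewrite patchE (negbTE xD).
Qed.

End IntegralMonotone.

(** * Integrability of the time weight *)

Section PowerIntegrals.
Context {R : realType}.
Local Notation leb := (@lebesgue_measure R).

Lemma integral_powR (e a b : R) : 0 < a -> a < b -> e != 0 ->
  (\int[leb]_(t in `[a, b]) (t `^ (e - 1))%:E = ((b `^ e - a `^ e) / e)%:E)%E.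
Proof.
move=> a0 ab e0.
have dF (x : R) : 0 < x -> is_derive x 1 (fun t : R => t `^ e / e) (x `^ (e - 1)).
  move=> x0; have := @is_derive1_powR R e x x0.
  move=> /(is_deriveZ (e^-1)) .
  have -> : e^-1 *: (e * x `^ (e - 1)) = x `^ (e - 1) by rewrite /GRing.scale /= mulrA mulVf// mul1r.
  by congr is_derive; apply/funext => t; rewrite /GRing.scale /= mulrC.
have cont (r : R) (x : R) : 0 < x -> {for x, continuous (fun t : R => t `^ r)}.
  move=> x0; apply: differentiable_continuous; apply/derivable1_diffP.
  by have [] := @is_derive1_powR R r x x0.
have contF (x : R) : 0 < x -> {for x, continuous (fun t : R => t `^ e / e)}.
  by move=> x0; apply: differentiable_continuous; apply/derivable1_diffP; have [] := dF x x0.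
rewrite (@continuous_FTC2 _ _ (fun t => t `^ e / e))//.
- by rewrite -EFinB mulrBl.
- apply: continuous_in_subspaceT => x; rewrite inE /= in_itv /= => /andP[ax _].
  exact: cont (lt_le_trans a0 ax).
- split.
  + by move=> x /itvP axb; have [] := dF x _; rewrite ?(lt_trans a0) ?axb.
  + by apply: cvg_at_right_filter; exact: contF.
  + by apply: cvg_at_left_filter; apply: contF; exact: lt_trans ab.
- move=> x /itvP axb; rewrite derive1E; have x0 : 0 < x by rewrite (lt_trans a0) ?axb.
  by have [_ ->] := dF x x0.
Qed.

(** The weight [t `^ (-1 - s)] is integrable against [min 1 (C t)]: the linear
    factor repairs the singularity at [0]. *)
Lemma integral_min_powR_lty (s C : R) : 0 < s < 1 -> 0 <= C ->
  (\int[leb]_(t in `]0%R, +oo[) (Num.min 1 (C * t) * t `^ (-1 - s))%:E < +oo)%E.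
Proof.
move=> /andP[s0 s1] C0.
(* The bound on [F n], uniform in [n], splits the interval at [1]. *)
pose F (n : nat) : set R := `[n.+2%:R^-1, n.+2%:R]%classic.
pose f (t : R) : \bar R := (Num.min 1 (C * t) * t `^ (-1 - s))%:E.
have mf (D : set R) : measurable_fun D f.
  apply: measurable_funTS; apply/measurable_EFinP; apply: measurable_funM.
    by apply: measurable_minr => //; exact: measurable_funM.
  exact: measurable_powR.
have f0 t : 0 <= t -> (0 <= (Num.min 1 (C * t) * t `^ (-1 - s))%:E)%E.
  by move=> t0; rewrite lee_fin mulr_ge0 ?powR_ge0// le_min ler01 mulr_ge0.
have inv_gt0 n : 0 < n.+2%:R^-1 :> R by rewrite invr_gt0.
have inv_lt1 n : n.+2%:R^-1 < 1 :> R by rewrite invf_lt1// ltr1n.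
have FE : `]0%R, +oo[%classic = \bigcup_n F n.
  apply/seteqP; split => [x|x [n _]]; rewrite /F /= !in_itv /= ?andbT; last first.
    by move=> /andP[+ _]; exact: lt_le_trans.
  move=> x0; have xx0 : 0 <= x + x^-1 by rewrite addr_ge0 ?invr_ge0 ?(ltW x0).
  have := archi_boundP xx0; set n := Num.bound _ => xn.
  exists n => //=; rewrite in_itv /=.
  have nn : n%:R <= n.+2%:R :> R by rewrite ler_nat; exact: leqW (leqnSn _).
  apply/andP; split; last by rewrite (le_trans _ nn)// (le_trans _ (ltW xn))// lerDl invr_ge0 ltW.
  rewrite -[leRHS]invrK lef_pV2 ?posrE ?invr_gt0//.
  by rewrite (le_trans _ nn)// (le_trans _ (ltW xn))// lerDr ltW.
have Fbnd n : (\int[leb]_(t in F n) (Num.min 1 (C * t) * t `^ (-1 - s))%:E <=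
    (C / (1 - s) + s^-1)%:E)%E.
  have -> : F n = `[n.+2%:R^-1, 1]%classic `|` `]1, n.+2%:R]%classic.
    apply/seteqP; split => x; rewrite /F /= !in_itv /=.
      by move=> /andP[-> ->]; rewrite andbT; case: (leP x 1) => _; [left|right].
    have n1 : 1 <= n.+2%:R :> R by rewrite ler1n.
    move=> [/andP[-> x1]|/andP[x1 ->]]; first by rewrite (le_trans x1).
    by rewrite andbT ltW// (lt_trans _ x1).
  rewrite ge0_integral_setU//=; first last.
  - rewrite disj_set2E; apply/eqP/seteqP; split => x //=; rewrite !in_itv /= => -[/andP[_ x1] /andP[]].
    by rewrite ltNge x1.
  - move=> x [|]; rewrite /= in_itv /= => /andP[x1 _]; apply: f0.
      exact: le_trans (ltW (inv_gt0 n)) x1.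
    exact: le_trans (ltW x1).
  - exact: mf.
  rewrite EFinD; apply: leeD.
    apply: (@le_trans _ _ (\int[leb]_(t in `[n.+2%:R^-1%R, 1%R]) (C%:E * (t `^ (1 - s - 1))%:E))%E).
      apply: nonneg_le_integral => t; rewrite /= in_itv /= => /andP[t1 _].
        exact: f0 (le_trans (ltW (inv_gt0 n)) t1).
      have t0 := lt_le_trans (inv_gt0 n) t1.
      rewrite -EFinM lee_fin (_ : 1 - s - 1 = 1 + (-1 - s)); last by ring.
      rewrite (@powRD _ t 1 (-1 - s)) ?(gt_eqF t0) ?implybT// powRr1 ?(ltW t0)// mulrA ler_wpM2r ?powR_ge0//.
      by rewrite ge_min lexx orbT.
    rewrite ge0_integralZl_EFin//; first last.
    - by apply: measurable_funTS; apply/measurable_EFinP; exact: measurable_powR.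
    - by move=> x _; rewrite lee_fin powR_ge0.
    rewrite integral_powR ?subr_eq0 ?gt_eqF//.
    rewrite -EFinM lee_fin ler_wpM2l// ler_piMl ?invr_ge0 ?subr_ge0 ?(ltW s1)//.
    by rewrite powR1 lerBlDr lerDl powR_ge0.
  apply: (@le_trans _ _ (\int[leb]_(t in `[1%R, n.+2%:R]) ((t `^ (- s - 1))%:E))%E).
    apply: (@le_trans _ _ (\int[leb]_(t in `]1%R, n.+2%:R]) ((t `^ (- s - 1))%:E))%E).
      apply: nonneg_le_integral => t; rewrite /= in_itv /= => /andP[t1 _].
        exact: f0 (le_trans ler01 (ltW t1)).
      rewrite lee_fin (_ : - s - 1 = - 1 - s); last by ring.
      by rewrite ler_piMl ?powR_ge0// ge_min lexx.
    apply: ge0_subset_integral => //.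
      by apply: measurable_funTS; apply/measurable_EFinP; exact: measurable_powR.
      by move=> x _; rewrite lee_fin powR_ge0.
    by move=> x; rewrite /= !in_itv /= => /andP[/ltW -> ->].
  rewrite integral_powR ?oppr_eq0 ?gt_eqF ?ltr1n// lee_fin powR1.
  rewrite invrN mulrN -mulNr opprB -[leRHS]mul1r ler_wpM2r ?invr_ge0 ?(ltW s0)//.
rewrite FE; apply: (@le_lt_trans _ _ (C / (1 - s) + s^-1)%:E); last exact: ltry.
have ndF : nondecreasing_seq F.
  move=> n m nm; apply/subsetPset => x; rewrite /F /= !in_itv /= => /andP[nx xn].
  have nm2 : n.+2%:R <= m.+2%:R :> R by rewrite ler_nat !ltnS.
  rewrite (le_trans xn)// andbT (le_trans _ nx)// lef_pV2 ?posrE//.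
have cvgF : (\int[leb]_(t in F n) f t)%E @[n --> \oo] -->
    (\int[leb]_(t in \bigcup_n F n) f t)%E.
  apply: ge0_nondecreasing_set_cvg_integral => //.
    by move=> n; exact: measurable_itv.
    by move=> n; exact: mf.
  move=> n x; rewrite /F /= in_itv /= => /andP[nx _]; apply: f0.
  exact: le_trans (ltW (inv_gt0 n)) nx.
rewrite -[leLHS](cvg_lim _ cvgF)//; apply: lime_le; first exact: cvgP cvgF.
exact: nearW.
Qed.
End PowerIntegrals.

(** * Summability of the fractional weights *)

Section FracWeight.
Context {R : realType} {V : countType}.
Variable G : weighted_graph R V.
Hypothesis Gsc : stochastically_complete G.
Variable s : R.
Hypothesis s01 : 0 < s < 1.
Local Notation mu := (vmeas G).
Local Open Scope ereal_scope.

Lemma frac_weight_ge0 x y : 0 <= frac_weight G s x y.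
Proof.
have /andP[s0 _] := s01.
rewrite mule_ge0//; last first.
  apply: integral_ge0 => t _; rewrite mule_ge0 ?heat_kernel_ge0//.
  by rewrite lee_fin powR_ge0.
rewrite lee_fin !mulr_ge0 ?(ltW (vmeas_gt0 _ _)) ?(ltW s0)// invr_ge0.
by apply: Rintegral_ge0 => t _; rewrite mulr_ge0 ?powR_ge0 ?expR_ge0.
Qed.

(** The total mass is [1], so the mass off the diagonal is at most [1], and at
    most what [heat_kernel_diag_ge] allows to leave [x] before time [t]. *)
Lemma heat_kernel_off_diag_le x t (ys : seq V) : (0 < t)%R -> uniq ys -> x \notin ys ->
  \sum_(y <- ys) (heat_kernel G t x y * (mu y)%:E) <=
  (Num.min 1 (`|laplacian G \1_[set x] x| * t))%:E.
Proof.
move=> t0 uys xys; set d := laplacian _ _ _.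
have fin (zs : seq V) : uniq zs ->
    \sum_(y <- zs) (heat_kernel G t x y * (mu y)%:E) <= 1.
  move=> uzs; rewrite -(Gsc x t0); apply: ereal_sup_ubound.
  exists [set` zs]; first by split => //; exact: finite_seq.
  by rewrite -fsbig_seq.
have S0 : 0 <= \sum_(y <- ys) (heat_kernel G t x y * (mu y)%:E).
  by apply: sume_ge0 => y _; rewrite mule_ge0 ?heat_kernel_ge0// lee_fin ltW ?vmeas_gt0.
have := fin (x :: ys); rewrite /= xys uys => /(_ isT); rewrite big_cons.
have := fin _ uys; move: S0.
have : (1 + t * d)%:E <= heat_kernel G t x x * (mu x)%:E.
  rewrite -[(1 + _)%R](divfK (vmeas_neq0 G x)) EFinM.
  by rewrite lee_wpmul2r ?heat_kernel_diag_ge// lee_fin ltW ?vmeas_gt0.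
case: (\sum_(y <- ys) _) => [S| |]//; case: (heat_kernel _ _ _ _ * _) => [h| |]//.
rewrite !lee_fin => dh S0 S1 hS; rewrite le_min S1 /=.
have : (- d <= `|d|)%R by rewrite -normrN ler_norm.
nra.
Qed.

(** Summing under the integral reduces the claim to the integrability of
    [Num.min 1 (d * t)] against the time weight. *)
Lemma frac_weight_sum_le x : exists D : R, forall ys : seq V, uniq ys -> x \notin ys ->
  \sum_(y <- ys) frac_weight G s x y <= D%:E.
Proof.
have /andP[s0 s1] := s01.
have [d d0 dE] : exists2 d : R, (0 <= d)%R & `|laplacian G \1_[set x] x|%R = d.
  by exists `|laplacian G \1_[set x] x|%R.
have Ifin := integral_min_powR_lty s01 d0.
set I := \int[_]_(_ in _) _ in Ifin.
have I0 : 0 <= I.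
  apply: integral_ge0 => t /=; rewrite in_itv /= andbT => t0.
  by rewrite lee_fin mulr_ge0 ?powR_ge0// le_min ler01 /= mulr_ge0// ltW.
set c := (s / Gamma (1 - s) * mu x)%R.
have c0 : (0 <= c)%R.
  rewrite !mulr_ge0 ?(ltW (vmeas_gt0 _ _)) ?(ltW s0)// invr_ge0.
  by apply: Rintegral_ge0 => t _; rewrite mulr_ge0 ?powR_ge0 ?expR_ge0.
exists (c * fine I)%R => ys uys xys.
rewrite EFinM fineK ?ge0_fin_numE//.
have frac_weightE y : frac_weight G s x y <= c%:E *
    \int[lebesgue_measure]_(t in `]0%R, +oo[)
      (heat_kernel G t x y * (mu y)%:E * (t `^ (-1 - s))%:E).
  rewrite /frac_weight -/c EFinM -muleA lee_wpmul2l ?lee_fin//.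
  apply: le_trans (nonneg_integralZl_ge _ _ _) _.
  - exact/ltW/vmeas_gt0.
  - by move=> t _; rewrite mule_ge0 ?heat_kernel_ge0// lee_fin powR_ge0.
  rewrite le_eqVlt; apply/orP; left; apply/eqP; apply: eq_integral => t _.
  by rewrite muleA (muleC (mu y)%:E).
apply: (@le_trans _ _ (\sum_(y <- ys) (c%:E *
    \int[lebesgue_measure]_(t in `]0%R, +oo[)
      (heat_kernel G t x y * (mu y)%:E * (t `^ (-1 - s))%:E)))).
  by apply: lee_sum => y _; exact: frac_weightE.
have g0 y t : 0 <= heat_kernel G t x y * (mu y)%:E * (t `^ (-1 - s))%:E.
  by rewrite !mule_ge0 ?heat_kernel_ge0 ?lee_fin ?powR_ge0 ?(ltW (vmeas_gt0 _ _)).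
rewrite -ge0_sume_distrr; last by move=> y _; apply: integral_ge0 => t _; exact: g0.
rewrite lee_wpmul2l ?lee_fin//.
apply: le_trans (nonneg_integral_sum_le _ _ _) _; first by move=> y t _; exact: g0.
apply: nonneg_le_integral => t; first by move=> _; apply: sume_ge0.
rewrite /= in_itv /= andbT => t0.
rewrite -ge0_sume_distrl; last first.
  by move=> y _; rewrite mule_ge0 ?heat_kernel_ge0// lee_fin ltW ?vmeas_gt0.
rewrite EFinM lee_wpmul2r ?lee_fin ?powR_ge0//.
by rewrite -dE; exact: heat_kernel_off_diag_le.
Qed.

Lemma frac_weight_fin x y : x != y -> frac_weight G s x y \is a fin_num.
Proof.
move=> xy; have [D DP] := frac_weight_sum_le x.
rewrite ge0_fin_numE ?frac_weight_ge0//; apply: le_lt_trans (ltry D).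
by have := DP [:: y]; rewrite big_seq1; apply; rewrite ?inE.
Qed.

End FracWeight.

(** * Inequalities between powers *)

Section PowerInequalities.
Context {R : realType}.
Variable r : R.
Hypothesis r_ge1 : 1 <= r.
Implicit Types a b t : R.

Let r_gt0 : 0 < r. Proof. exact: lt_le_trans r_ge1. Qed.

Lemma powR_convex a b t : 0 <= a -> 0 <= b -> 0 <= t <= 1 ->
  (t * a + (1 - t) * b) `^ r <= t * a `^ r + (1 - t) * b `^ r.
Proof.
move=> a0 b0 /andP[t0 t1].
by have := convex_powR r_ge1 (Itv01 t0 t1) (x := a) (y := b); apply;
  rewrite !inE /= !in_itv /= ?a0 ?b0.
Qed.

Lemma powR_superadditive a b : 0 <= a -> 0 <= b ->
  a `^ r + b `^ r <= (a + b) `^ r.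
Proof.
move=> a0 b0; have ab0 : 0 <= a + b by rewrite addr_ge0.
rewrite -!(mulr_powRB1 _ r_gt0)// mulrDl.
by rewrite lerD// ler_wpM2l// ge0_ler_powR ?nnegrE ?subr_ge0 ?lerDl ?lerDr.
Qed.

(** The scalar core of Clarkson's inequality for exponents at least [2]: the
    hypothesis is the parallelogram law of a quadratic form, and the power
    [r = p / 2] is superadditive and convex. *)
Lemma powR_clarkson q1 q2 a b : 0 <= q1 -> 0 <= q2 -> 0 <= a -> 0 <= b ->
  q1 + q2 = (a + b) / 2 -> q1 `^ r + q2 `^ r <= (a `^ r + b `^ r) / 2.
Proof.
move=> q10 q20 a0 b0 q12.
apply: le_trans (powR_superadditive q10 q20) _; rewrite q12.
have t01 : 0 <= (2^-1 : R) <= 1 by rewrite invr_ge0 ler0n invf_le1 ?ler1n.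
have := powR_convex a0 b0 t01.
have -> : 2^-1 * a + (1 - 2^-1) * b = (a + b) / 2 by field.
by move/le_trans; apply; rewrite le_eqVlt; apply/orP; left; apply/eqP; field.
Qed.

Lemma sqr_convex a b t : 0 <= t <= 1 ->
  (t * a + (1 - t) * b) ^+ 2 <= t * a ^+ 2 + (1 - t) * b ^+ 2.
Proof.
move=> /andP[t0 t1]; rewrite -subr_ge0.
have -> : t * a ^+ 2 + (1 - t) * b ^+ 2 - (t * a + (1 - t) * b) ^+ 2 =
  t * (1 - t) * (a - b) ^+ 2 by ring.
by apply: mulr_ge0 (sqr_ge0 _); rewrite mulr_ge0// subr_ge0.
Qed.

End PowerInequalities.

(** * Sums over a countable type *)

Section Exhaustion.
Context {V : countType}.

Definition exhaust n : seq V := pmap pickle_inv (iota 0 n).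

Lemma mem_exhaust n x : (x \in exhaust n) = (pickle x < n)%N.
Proof.
by rewrite (can2_mem_pmap (@pickle_invK V) (@pickleK_inv V)) mem_iota.
Qed.

Lemma exhaust_uniq n : uniq (exhaust n).
Proof. by apply: (pmap_uniq (@pickle_invK V)); exact: iota_uniq. Qed.

Lemma sub_exhaust (s : seq V) : exists n, {subset s <= exhaust n}.
Proof.
exists (\max_(x <- s) (pickle x).+1) => x xs.
rewrite mem_exhaust; exact: leq_bigmax_seq.
Qed.

Lemma exhaust_sum_mono (R : realType) (f : V -> R) n m : (forall x, 0 <= f x) ->
  (n <= m)%N -> \sum_(x <- exhaust n) f x <= \sum_(x <- exhaust m) f x.
Proof.
move=> f0 nm; rewrite /exhaust -(subnKC nm) iotaD pmap_cat big_cat/= lerDl.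
by apply: sumr_ge0.
Qed.

(** An unordered sum of nonnegative terms is the supremum of its partial sums
    along an exhaustion. *)
Lemma esum_exhaust_le (R : realType) (f : V -> \bar R) (M : \bar R) :
  (forall x, 0 <= f x)%E ->
  (\esum_(x in [set: V]) f x <= M)%E <->
  (forall n, \sum_(x <- exhaust n) f x <= M)%E.
Proof.
move=> f0; split=> [fM n|fM].
  apply: le_trans fM; apply: ereal_sup_ubound; exists [set` exhaust n].
    by split => //; exact: finite_seq.
  by rewrite -fsbig_seq// exhaust_uniq.
apply: ge_ereal_sup => _ [_ [/finite_seqP[F ->] _] <-].
have [n Fn] := sub_exhaust F.
apply: le_trans (fM n); rewrite [leRHS]fsbig_seq ?exhaust_uniq//.
apply: lee_fsum_nneg_subset => //.
by move=> x; rewrite !inE; exact: Fn.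
Qed.

End Exhaustion.

(** * Partial energies *)

Section FiniteEnergy.
Context {R : realType} {V : countType}.
Variables (mu : V -> R) (w : V -> V -> R) (r : R).
Hypothesis mu_gt0 : forall x, 0 < mu x.
Hypothesis w_ge0 : forall x y, 0 <= w x y.
Hypothesis r_ge1 : 1 <= r.
Implicit Types (u v : V -> R).

Let r_gt0 : 0 < r. Proof. exact: lt_le_trans r_ge1. Qed.

(** The term [y = x] vanishes, so the sum may run over all of the exhaustion. *)
Definition gradsq n u x : R :=
  (2 * mu x)^-1 * \sum_(y <- exhaust n) w x y * (u x - u y) ^+ 2.

(** With [r = p / 2] both summands are [r]-th powers of nonnegative quadratic
    forms in [u], which is what convexity and Clarkson's inequality use. *)
Definition fin_energy n u : R :=
  \sum_(x <- exhaust n) mu x * (gradsq n u x `^ r + (u x ^+ 2) `^ r).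

Let c_ge0 x : 0 <= (2 * mu x)^-1.
Proof. by rewrite invr_ge0 mulr_ge0// ltW. Qed.

Lemma gradsq_ge0 n u x : 0 <= gradsq n u x.
Proof. by rewrite mulr_ge0// sumr_ge0// => y _; apply: mulr_ge0 (sqr_ge0 _). Qed.
#[local] Hint Resolve gradsq_ge0 : core.

Lemma gradsq_mono n m u x : (n <= m)%N -> gradsq n u x <= gradsq m u x.
Proof.
move=> nm; rewrite ler_wpM2l// exhaust_sum_mono// => y.
by apply: mulr_ge0 (sqr_ge0 _).
Qed.

Lemma gradsq_le n u v x :
  (forall y, `|u x - u y| <= `|v x - v y|) -> gradsq n u x <= gradsq n v x.
Proof.
move=> uv; rewrite ler_wpM2l// ler_sum// => y _; rewrite ler_wpM2l//.
by rewrite -(real_normK (num_real _)) -[leRHS](real_normK (num_real _)) lerXn2r ?nnegrE.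
Qed.

Lemma gradsqZ n a u x : gradsq n (fun z => a * u z) x = a ^+ 2 * gradsq n u x.
Proof.
rewrite /gradsq mulrCA; congr (_ * _); rewrite mulr_sumr; apply: eq_bigr => y _.
by rewrite -mulrBr exprMn mulrCA.
Qed.

Lemma gradsq_convex n t u v x : 0 <= t <= 1 ->
  gradsq n (fun z => t * u z + (1 - t) * v z) x <=
  t * gradsq n u x + (1 - t) * gradsq n v x.
Proof.
move=> t01; rewrite /gradsq !(mulrCA _ (2 * mu x)^-1) -mulrDr ler_wpM2l//.
rewrite !mulr_sumr -big_split /= ler_sum// => y _.
rewrite !(mulrCA _ (w x y)) -mulrDr ler_wpM2l//.
have -> : t * u x + (1 - t) * v x - (t * u y + (1 - t) * v y) =
  t * (u x - u y) + (1 - t) * (v x - v y) by ring.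
exact: sqr_convex.
Qed.

Lemma gradsq_parallelogram n u v x :
  gradsq n (fun z => 2^-1 * (u z + v z)) x + gradsq n (fun z => 2^-1 * (u z - v z)) x =
  (gradsq n u x + gradsq n v x) / 2.
Proof.
rewrite /gradsq -!mulrDr -mulrA; congr (_ * _).
rewrite -!big_split /= mulr_suml; apply: eq_bigr => y _.
by field.
Qed.

Lemma fin_energy_ge0 n u : 0 <= fin_energy n u.
Proof.
by rewrite sumr_ge0// => x _; rewrite mulr_ge0 ?addr_ge0 ?powR_ge0// ltW.
Qed.

Lemma fin_energy_mono n m u : (n <= m)%N -> fin_energy n u <= fin_energy m u.
Proof.
move=> nm; rewrite (@le_trans _ _
  (\sum_(x <- exhaust n) mu x * (gradsq m u x `^ r + (u x ^+ 2) `^ r)))//.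
  rewrite ler_sum// => x _; rewrite ler_wpM2l ?(ltW (mu_gt0 x))// lerD2r.
  by rewrite ge0_ler_powR ?nnegrE ?(ltW r_gt0)// gradsq_mono.
rewrite exhaust_sum_mono// => x; rewrite mulr_ge0 ?addr_ge0 ?powR_ge0//.
exact: ltW.
Qed.

Lemma fin_energy_le n u v : (forall x, `|u x| <= `|v x|) ->
  (forall x y, `|u x - u y| <= `|v x - v y|) ->
  fin_energy n u <= fin_energy n v.
Proof.
move=> uv duv; rewrite ler_sum// => x _; rewrite ler_wpM2l ?(ltW (mu_gt0 x))//.
rewrite lerD// ge0_ler_powR ?nnegrE ?(ltW r_gt0) ?sqr_ge0//.
  exact: gradsq_le.
by rewrite -(real_normK (num_real _)) -[leRHS](real_normK (num_real _)) lerXn2r ?nnegrE.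
Qed.

Lemma fin_energyZ n a u :
  fin_energy n (fun x => a * u x) = (a ^+ 2) `^ r * fin_energy n u.
Proof.
rewrite /fin_energy mulr_sumr; apply: eq_bigr => x _.
rewrite gradsqZ exprMn (powRM _ (sqr_ge0 a) (gradsq_ge0 n u x)).
by rewrite (powRM _ (sqr_ge0 a) (sqr_ge0 (u x))) -mulrDr mulrCA.
Qed.

Lemma fin_energy_convex n t u v : 0 <= t <= 1 ->
  fin_energy n (fun x => t * u x + (1 - t) * v x) <=
  t * fin_energy n u + (1 - t) * fin_energy n v.
Proof.
move=> t01; have /andP[t0 t1] := t01.
rewrite /fin_energy !mulr_sumr -big_split /= ler_sum// => x _.
rewrite !(mulrCA _ (mu x)) -mulrDr ler_wpM2l ?(ltW (mu_gt0 x))//.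
have key q a b : 0 <= q -> 0 <= a -> 0 <= b -> q <= t * a + (1 - t) * b ->
    q `^ r <= t * a `^ r + (1 - t) * b `^ r.
  move=> q0 a0 b0 qab; apply: le_trans (powR_convex r_ge1 a0 b0 t01).
  by rewrite ge0_ler_powR ?nnegrE ?(ltW r_gt0)// addr_ge0 ?mulr_ge0// subr_ge0.
have := key _ _ _ (gradsq_ge0 n _ x) (gradsq_ge0 n u x) (gradsq_ge0 n v x) (gradsq_convex n u v x t01).
have := key _ _ _ (sqr_ge0 _) (sqr_ge0 (u x)) (sqr_ge0 (v x)) (sqr_convex (u x) (v x) t01).
lra.
Qed.

Lemma fin_energy_clarkson n u v :
  fin_energy n (fun x => 2^-1 * (u x + v x)) +
  fin_energy n (fun x => 2^-1 * (u x - v x)) <=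
  (fin_energy n u + fin_energy n v) / 2.
Proof.
rewrite /fin_energy -!big_split /= mulr_suml ler_sum// => x _.
rewrite -!mulrDr -mulrA ler_wpM2l ?(ltW (mu_gt0 x))//.
have := powR_clarkson r_ge1 (gradsq_ge0 n _ x) (gradsq_ge0 n _ x) (gradsq_ge0 n u x) (gradsq_ge0 n v x) (gradsq_parallelogram n u v x).
have sq : (2^-1 * (u x + v x)) ^+ 2 + (2^-1 * (u x - v x)) ^+ 2 =
    (u x ^+ 2 + v x ^+ 2) / 2 by field.
have := powR_clarkson r_ge1 (sqr_ge0 _) (sqr_ge0 _) (sqr_ge0 (u x)) (sqr_ge0 (v x)) sq.
lra.
Qed.

Lemma fin_energy_eval u x : mu x * (u x ^+ 2) `^ r <= fin_energy (pickle x).+1 u.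
Proof.
rewrite /fin_energy (bigD1_seq x) ?exhaust_uniq ?mem_exhaust//=.
have mx := mu_gt0 x; apply: (@le_trans _ _ (mu x * (gradsq (pickle x).+1 u x `^ r + (u x ^+ 2) `^ r))).
  by rewrite ler_wpM2l ?(ltW mx)// lerDr powR_ge0.
rewrite lerDl sumr_ge0// => y _; rewrite mulr_ge0 ?addr_ge0 ?powR_ge0//.
exact: ltW.
Qed.

(** Lower semicontinuity under pointwise convergence.  As [u] is a convex
    combination, with most of the weight on a nearby [v], of [v] and of a
    function within distance [1] of [u], convexity reduces the claim to a bound
    on the latter. *)
Lemma fin_energy_lsc n u M :
  (forall d, 0 < d -> exists v, fin_energy n v <= M /\
    forall x, x \in exhaust n -> `|v x - u x| <= d) ->
  fin_energy n u <= M.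
Proof.
move=> approx.
(* [B] bounds the energy of every function within [1] of [u]. *)
pose B := \sum_(x <- exhaust n) mu x * (
  ((2 * mu x)^-1 * \sum_(y <- exhaust n) w x y * (`|u x - u y| + 2) ^+ 2) `^ r +
  ((`|u x| + 1) ^+ 2) `^ r).
have Bz z : (forall x, x \in exhaust n -> `|z x - u x| <= 1) -> fin_energy n z <= B.
  move=> zu; rewrite /fin_energy /B big_seq [leRHS]big_seq ler_sum// => x xn.
  rewrite ler_wpM2l ?(ltW (mu_gt0 x))//.
  have zx := zu x xn.
  rewrite lerD// ge0_ler_powR ?nnegrE ?(ltW r_gt0) ?sqr_ge0//.
  - rewrite mulr_ge0// sumr_ge0// => y _; exact: mulr_ge0 (sqr_ge0 _).
  - rewrite /gradsq ler_wpM2l// big_seq [leRHS]big_seq ler_sum// => y yn.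
    rewrite ler_wpM2l// -(real_normK (num_real (z x - z y))) lerXn2r ?nnegrE ?addr_ge0//.
    have zy := zu y yn.
    have -> : z x - z y = (u x - u y) + ((z x - u x) - (z y - u y)) by ring.
    rewrite (le_trans (ler_normD _ _))// lerD2l (le_trans (ler_normB _ _))//.
    by rewrite (_ : 2 = 1 + 1 :> R)// lerD.
  - rewrite -(real_normK (num_real (z x))) lerXn2r ?nnegrE ?addr_ge0//.
    by rewrite -{1}(subrK (u x) (z x)) addrC (le_trans (ler_normD _ _))// lerD.
have B0 : 0 <= B by apply: le_trans (Bz u _); rewrite ?fin_energy_ge0// => x _; rewrite subrr normr0.
have M0 : 0 <= M.
  by have [v [vM _]] := approx 1 ltr01; apply: le_trans vM; exact: fin_energy_ge0.
apply/ler_addgt0Pr => e e0.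
pose t := e / (B + e + 1).
have Be : 0 < B + e + 1 by rewrite ltr_wpDl// addr_ge0// ltW.
have t0 : 0 < t by rewrite divr_gt0.
have t1 : t <= 1 by rewrite ler_pdivrMr// mul1r; lra.
have [v [vM vu]] := approx t t0.
(* Solves [u = t z + (1 - t) v]. *)
pose z x := u x + t^-1 * (1 - t) * (u x - v x).
have -> : u = fun x => t * z x + (1 - t) * v x.
  by apply/funext => x; rewrite /z; field; rewrite gt_eqF.
have t01 : 0 <= t <= 1 by rewrite ltW.
apply: le_trans (fin_energy_convex n z v t01) _.
have zB : fin_energy n z <= B.
  apply: Bz => x xn; rewrite /z addrC addKr normrM normrM gtr0_norm ?invr_gt0//.
  rewrite ger0_norm ?subr_ge0// -mulrA mulrC ler_pdivrMr// mul1r distrC.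
  by rewrite (le_trans _ (vu x xn))// ler_piMl// lerBlDr lerDl ltW.
have tB : t * (B + e + 1) = e by rewrite /t divfK// gt_eqF.
have := fin_energy_ge0 n z; have := fin_energy_ge0 n v.
move: zB vM; move: (fin_energy _ _) (fin_energy _ _) => a b.
nra.
Qed.

End FiniteEnergy.

(** * The fractional Sobolev space *)

Section SobolevEnergy.
Context {R : realType} {V : countType}.
Variables (G : weighted_graph R V) (s p : R).
Hypothesis Glf : locally_finite G.
Hypothesis Gsc : stochastically_complete G.
Hypothesis s01 : 0 < s < 1.
Hypothesis p_ge2 : 2 <= p.
Hypothesis mu_inf : 0 < inf (range (vmeas G)).
Local Notation mu := (vmeas G).
Implicit Types (u v : V -> R).

Let p_gt0 : 0 < p. Proof. exact: lt_le_trans p_ge2. Qed.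
Let p_gt1 : 1 < p. Proof. by apply: lt_le_trans p_ge2; rewrite ltr1n. Qed.

(** Finite off the diagonal by [real_weightE]; the value on the diagonal is
    always multiplied by [0]. *)
Definition real_weight x y : R := fine (frac_weight G s x y).
Local Notation w := real_weight.
Local Notation r := (2^-1 * p).
Local Notation FE := (fin_energy mu w r).

Let r_ge1 : 1 <= r. Proof. by rewrite mulrC ler_pdivlMr// mul1r. Qed.
Let r_gt0 : 0 < r. Proof. exact: lt_le_trans r_ge1. Qed.
Let mu_gt0 : forall x, 0 < mu x. Proof. exact: vmeas_gt0. Qed.
Let w_ge0 x y : 0 <= w x y. Proof. by rewrite fine_ge0// frac_weight_ge0. Qed.
Let mu2_gt0 x : 0 < 2 * mu x. Proof. by rewrite mulr_gt0. Qed.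

Lemma real_weightE x y : x != y -> frac_weight G s x y = (w x y)%:E.
Proof. by move=> xy; rewrite fineK// frac_weight_fin. Qed.

Lemma real_weightC x y : w x y = w y x.
Proof. by rewrite /w frac_weightC. Qed.

Lemma sqr_powR (a : R) : (a ^+ 2) `^ r = `|a| `^ p.
Proof.
rewrite -(real_normK (num_real a)) -powR_mulrn// -powRrM mulrA mulfV ?mul1r//.
Qed.

(** The squared fractional gradient, as the limit of [gradsq]. *)
Definition ext_gradsq u x : \bar R :=
  ((2 * mu x)^-1%:E * \esum_(y in [set: V]) (w x y * (u x - u y) ^+ 2)%:E)%E.

Lemma frac_grad_powR u x : (frac_grad G s u x `^ p = ext_gradsq u x `^ r)%E.
Proof.
rewrite /frac_grad -poweRrM /ext_gradsq; congr ((_ * _) `^ _)%E.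
rewrite esum_mkcond; apply: eq_esum => y _; have [->|yx] := eqVneq y x.
  by rewrite memNset ?subrr ?expr0n ?mulr0//= => /(_ erefl).
by rewrite mem_set ?real_weightE 1?eq_sym//=; exact/eqP.
Qed.

Lemma sobolev_energyE u : sobolev_energy G s p u =
  (\esum_(x in [set: V]) ((ext_gradsq u x `^ r + ((u x ^+ 2) `^ r)%:E) * (mu x)%:E))%E.
Proof.
rewrite /sobolev_energy /vint; apply: eq_esum => x _.
by rewrite frac_grad_powR sqr_powR.
Qed.

Lemma ext_gradsq_le u x (B : \bar R) :
  (ext_gradsq u x <= B)%E <-> (forall m, ((gradsq mu w m u x)%:E <= B)%E).
Proof.
rewrite /ext_gradsq lee_pdivrMl// esum_exhaust_le; last first.
  by move=> y; rewrite lee_fin; exact: mulr_ge0 (w_ge0 _ _) (sqr_ge0 _).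
have step m : ((gradsq mu w m u x)%:E <= B)%E =
    (\sum_(y <- exhaust m) (w x y * (u x - u y) ^+ 2)%:E <= (2 * mu x)%:E * B)%E.
  by rewrite sumEFin /gradsq [in LHS]EFinM lee_pdivrMl.
by split=> H m; have := H m; rewrite step.
Qed.

Lemma ext_gradsq_ge0 u x : (0 <= ext_gradsq u x)%E.
Proof.
rewrite mule_ge0 ?lee_fin ?invr_ge0 ?(ltW (mu2_gt0 x))//.
by apply: esum_ge0 => y _; rewrite lee_fin; exact: mulr_ge0 (w_ge0 _ _) (sqr_ge0 _).
Qed.

(** At finitely many vertices the partial gradients simultaneously reach any
    proportion [theta < 1] of the full ones. *)
Lemma gradsq_near (g : V -> R) theta (xs : seq V) u : 0 <= theta < 1 ->
  (forall x, ext_gradsq u x = (g x)%:E) ->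
  exists m, forall n x, (m <= n)%N -> x \in xs -> theta * g x <= gradsq mu w n u x.
Proof.
move=> /andP[th0 th1] gE.
have g0 x : 0 <= g x by rewrite -lee_fin -gE ext_gradsq_ge0.
elim: xs => [|x xs [m mP]]; first by exists 0%N.
have [k kP] : exists k, theta * g x <= gradsq mu w k u x.
  have [gx0|gx0] := eqVneq (g x) 0.
    by exists 0%N; rewrite gx0 mulr0 gradsq_ge0.
  apply: contrapT => nk; have : (ext_gradsq u x <= (theta * g x)%:E)%E.
    apply/ext_gradsq_le => m'; rewrite lee_fin leNgt; apply/negP => lt.
    by apply: nk; exists m'; exact: ltW.
  rewrite gE lee_fin; have : 0 < g x by rewrite lt_neqAle eq_sym gx0 g0.
  nra.
exists (maxn m k) => n y; rewrite geq_max => /andP[mn kn].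
rewrite inE => /orP[/eqP ->|]; last exact: mP.
by rewrite (le_trans kP)// gradsq_mono.
Qed.

(** The energy is the supremum of the partial energies, although these truncate
    the outer and the inner sum at the same stage.  The inner sums are replaced
    by a proportion [theta] of their limits, and [theta] tends to [1]. *)
Lemma sobolev_energy_le u M :
  (sobolev_energy G s p u <= M%:E)%E <-> (forall n, FE n u <= M).
Proof.
rewrite sobolev_energyE esum_exhaust_le; last first.
  by move=> x; rewrite mule_ge0 ?adde_ge0 ?poweR_ge0 ?lee_fin ?powR_ge0 ?(ltW (mu_gt0 x)).
split=> [H n|H].
  rewrite -lee_fin; apply: le_trans (H n); rewrite /fin_energy -sumEFin.
  apply: lee_sum => x _; rewrite EFinM muleC lee_wpmul2r ?lee_fin ?(ltW (mu_gt0 x))//.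
  rewrite EFinD leeD2r// -poweR_EFin; apply: gt0_ler_poweR; rewrite ?(ltW r_gt0)//.
  - by rewrite in_itv /= leey andbT lee_fin gradsq_ge0.
  - by rewrite in_itv /= leey andbT ext_gradsq_ge0.
  - by have /ext_gradsq_le := lexx (ext_gradsq u x); apply.
have gfin x : ext_gradsq u x \is a fin_num.
  rewrite ge0_fin_numE ?ext_gradsq_ge0//.
  apply: (@le_lt_trans _ _ ((M / mu x) `^ r^-1)%:E); last exact: ltry.
  apply/ext_gradsq_le => m; rewrite lee_fin.
  have -> : gradsq mu w m u x = (gradsq mu w m u x `^ r) `^ r^-1.
    by rewrite -powRrM mulfV ?gt_eqF// powRr1// gradsq_ge0.
  have gM : gradsq mu w m u x `^ r <= M / mu x.
    rewrite ler_pdivlMr// mulrC; pose k := maxn m (pickle x).+1.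
    apply: le_trans (H k).
    rewrite /fin_energy (bigD1_seq x) ?exhaust_uniq ?mem_exhaust ?leq_maxr//=.
    apply: (@le_trans _ _ (mu x * (gradsq mu w k u x `^ r + (u x ^+ 2) `^ r))).
      rewrite ler_wpM2l ?(ltW (mu_gt0 x))//.
      apply: (@le_trans _ _ (gradsq mu w k u x `^ r)); last by rewrite lerDl powR_ge0.
      by rewrite ge0_ler_powR ?nnegrE ?gradsq_ge0 ?(ltW r_gt0)// gradsq_mono// leq_maxl.
    rewrite lerDl sumr_ge0// => y _; rewrite mulr_ge0 ?addr_ge0 ?powR_ge0//.
    exact: ltW.
  by rewrite ge0_ler_powR ?nnegrE ?invr_ge0 ?(ltW r_gt0) ?powR_ge0// (le_trans _ gM) ?powR_ge0.
pose g x := fine (ext_gradsq u x).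
have gE x : ext_gradsq u x = (g x)%:E by rewrite fineK.
have g0 x : 0 <= g x by rewrite -lee_fin -gE ext_gradsq_ge0.
move=> n.
pose a := \sum_(x <- exhaust n) mu x * g x `^ r.
pose b := \sum_(x <- exhaust n) mu x * (u x ^+ 2) `^ r.
have a0 : 0 <= a.
  by rewrite sumr_ge0// => x _; rewrite mulr_ge0 ?powR_ge0// ltW.
have -> : (\sum_(x <- exhaust n) ((ext_gradsq u x `^ r + ((u x ^+ 2) `^ r)%:E) * (mu x)%:E) = (a + b)%:E)%E.
  rewrite /a /b -big_split /= -sumEFin; apply: eq_bigr => x _.
  by rewrite gE poweR_EFin -EFinD -EFinM -mulrDr mulrC.
rewrite lee_fin; apply/ler_addgt0Pr => e e0.
(* Chosen so that [(1 - tau) * a <= e]; [tau] is [theta `^ r]. *)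
pose tau := (a + 1) / (a + 1 + e).
have ae : 0 < a + 1 + e by rewrite ltr_wpDl ?addr_ge0.
have tau0 : 0 < tau by rewrite divr_gt0// ltr_wpDl.
have tau1 : tau < 1 by rewrite ltr_pdivrMr// mul1r ltrDl.
have tauE : tau * (a + 1 + e) = a + 1 by rewrite divfK// gt_eqF.
pose theta := tau `^ r^-1.
have thE : theta `^ r = tau by rewrite /theta -powRrM mulVf ?gt_eqF// powRr1// ltW.
have th01 : 0 <= theta < 1.
  rewrite powR_ge0 /=; have -> : 1 = 1 `^ r^-1 :> R by rewrite powR1.
  by apply: gt0_ltr_powR; rewrite ?nnegrE ?invr_gt0 ?(ltW tau0).
have [m mP] := gradsq_near (exhaust n) th01 gE.
have : tau * a + b <= M.
  apply: le_trans (H (maxn n m)).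
  apply: (@le_trans _ _ (\sum_(x <- exhaust n) mu x *
      (gradsq mu w (maxn n m) u x `^ r + (u x ^+ 2) `^ r))).
    rewrite /a /b mulr_sumr -big_split /= big_seq [leRHS]big_seq ler_sum// => x xn.
    rewrite mulrCA -mulrDr ler_wpM2l ?(ltW (mu_gt0 x))// lerD2r -thE -powRM ?(andP th01).1//.
    rewrite ge0_ler_powR ?nnegrE ?gradsq_ge0 ?(ltW r_gt0) ?mulr_ge0 ?(andP th01).1//.
    by apply: mP => //; rewrite leq_maxr.
  rewrite exhaust_sum_mono ?leq_maxl// => x.
  by rewrite mulr_ge0 ?addr_ge0 ?powR_ge0// ltW.
have := tauE; nra.
Qed.


Let mu_ge x : inf (range mu) <= mu x.
Proof.
apply: ge_inf; last by exists x.
by exists 0 => _ [y _ <-]; exact: ltW.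
Qed.

Lemma fin_energy_sup_bound u M x : (forall n, FE n u <= M) ->
  `|u x| <= (M / inf (range mu)) `^ p^-1.
Proof.
move=> H; have := le_trans (fin_energy_eval w r mu_gt0 u x) (H _).
rewrite sqr_powR => uM.
have -> : `|u x| = (`|u x| `^ p) `^ p^-1.
  by rewrite -powRrM mulfV ?gt_eqF// powRr1.
have uM' : `|u x| `^ p <= M / inf (range mu).
  rewrite ler_pdivlMr// mulrC (le_trans _ uM)// ler_wpM2r ?powR_ge0//.
by rewrite ge0_ler_powR ?nnegrE ?invr_ge0 ?(ltW p_gt0) ?powR_ge0// (le_trans _ uM') ?powR_ge0.
Qed.

Lemma sobolev_energy_ge0 u : (0 <= sobolev_energy G s p u)%E.
Proof.
rewrite sobolev_energyE; apply: esum_ge0 => x _.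
by rewrite mule_ge0 ?adde_ge0 ?poweR_ge0 ?lee_fin ?powR_ge0 ?(ltW (mu_gt0 x)).
Qed.

(** The energy controls [u] uniformly by [fin_energy_sup_bound], so bounded
    partial energies also give the boundedness that [sobolev] asks for. *)
Lemma sobolevP u : sobolev G s p u <-> exists M, forall n, FE n u <= M.
Proof.
split=> [[_ uE]|[M uM]].
  exists (fine (sobolev_energy G s p u)); apply/sobolev_energy_le.
  by rewrite fineK// ge0_fin_numE ?sobolev_energy_ge0.
split; last by apply: (le_lt_trans _ (ltry M)); exact/sobolev_energy_le.
rewrite /Lq /=; apply: le_lt_trans (ltry ((M / inf (range mu)) `^ p^-1)).
apply: ge_ereal_sup => _ [x _ <-]; rewrite lee_fin.
exact: fin_energy_sup_bound.
Qed.

Local Notation E u := (fine (sobolev_energy G s p u)).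

Lemma sobolev_energy_fine u : sobolev G s p u ->
  sobolev_energy G s p u = (E u)%:E.
Proof. by move=> [_ uE]; rewrite fineK// ge0_fin_numE ?sobolev_energy_ge0. Qed.

Lemma fine_energy_le u M : sobolev G s p u ->
  E u <= M <-> (forall n, FE n u <= M).
Proof. by move=> Su; rewrite -sobolev_energy_le sobolev_energy_fine// lee_fin. Qed.

Lemma fin_energy_fine u n : sobolev G s p u -> FE n u <= E u.
Proof. by move=> Su; have /(fine_energy_le _ Su) := lexx (E u); exact. Qed.

Lemma fine_energy_ge0 u : 0 <= E u.
Proof. by rewrite fine_ge0// sobolev_energy_ge0. Qed.

(** Both energies on the left are limits along the same exhaustion, so their
    sum is controlled by the sum of the partial energies. *)
Lemma fine_energyD_le u v M : sobolev G s p u -> sobolev G s p v ->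
  (forall n, FE n u + FE n v <= M) -> E u + E v <= M.
Proof.
move=> Su Sv H; rewrite -lerBrDr; apply/fine_energy_le => // n.
rewrite lerBrDr addrC -lerBrDr; apply/fine_energy_le => // m.
rewrite lerBrDr addrC; apply: le_trans (H (maxn n m)).
by apply: lerD; apply: fin_energy_mono; rewrite ?leq_maxl ?leq_maxr.
Qed.

(** Convexity at the midpoint of [2 a u] and [2 b v]. *)
Lemma sobolev_comb a b u v : sobolev G s p u -> sobolev G s p v ->
  sobolev G s p (fun x => a * u x + b * v x).
Proof.
move=> Su Sv; apply/sobolevP.
exists (2^-1 * (((2 * a) ^+ 2) `^ r * E u) + (1 - 2^-1) * (((2 * b) ^+ 2) `^ r * E v)) => n.
have -> : (fun x => a * u x + b * v x) =
    (fun x => 2^-1 * (2 * a * u x) + (1 - 2^-1) * (2 * b * v x)).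
  by apply/funext => x; field.
have t01 : 0 <= (2^-1 : R) <= 1 by rewrite invr_ge0 ler0n invf_le1 ?ler1n.
apply: le_trans (fin_energy_convex mu_gt0 w_ge0 r_ge1 n _ _ t01) _.
rewrite !fin_energyZ//; have /andP[t0 t1] := t01.
apply: lerD; rewrite ler_wpM2l// ?subr_ge0//;
  by rewrite ler_wpM2l ?powR_ge0// fin_energy_fine.
Qed.

Lemma sobolev0 : sobolev G s p (fun=> 0).
Proof.
apply/sobolevP; exists 0 => n; rewrite /fin_energy big1// => x _.
rewrite /gradsq big1 => [|y _]; last by rewrite subrr expr0n mulr0.
by rewrite mulr0 expr0n powR0 ?gt_eqF// addr0 mulr0.
Qed.

Lemma sobolevZ a u : sobolev G s p u -> sobolev G s p (fun x => a * u x).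
Proof.
move=> Su; have := sobolev_comb a 0 Su sobolev0; congr sobolev.
by apply/funext => x; rewrite mulr0 addr0.
Qed.

Let fine_energyZ_le a u : sobolev G s p u ->
  E (fun x => a * u x) <= `|a| `^ p * E u.
Proof.
move=> Su; apply/fine_energy_le => [|n]; first exact: sobolevZ.
by rewrite fin_energyZ// sqr_powR ler_wpM2l ?powR_ge0// fin_energy_fine.
Qed.

Lemma fine_energyZ a u : sobolev G s p u ->
  E (fun x => a * u x) = `|a| `^ p * E u.
Proof.
move=> Su; apply/eqP; rewrite eq_le fine_energyZ_le//=.
have [->|a0] := eqVneq a 0.
  by rewrite normr0 powR0 ?gt_eqF// mul0r fine_energy_ge0.
have := fine_energyZ_le a^-1 (sobolevZ a Su).
have -> : (fun x => a^-1 * (a * u x)) = u.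
  by apply/funext => x; rewrite mulrA mulVf// mul1r.
have na : 0 < `|a| `^ p by apply: powR_gt0; rewrite normr_gt0.
move=> H; rewrite -ler_pdivlMl//; apply: le_trans H _.
by rewrite normfV -powR_inv1// -powRrM mulN1r powRN.
Qed.

Lemma sobolev_clarkson_energy :
  clarkson_energy p (sobolev G s p) (fun u => E u).
Proof.
have t01 : 0 <= (2^-1 : R) <= 1 by rewrite invr_ge0 ler0n invf_le1 ?ler1n.
split.
- exact: sobolev0.
- move=> a u v Su Sv; have := sobolev_comb a 1 Su Sv; congr sobolev.
  by apply/funext => x; rewrite mul1r.
- exact: fine_energy_ge0.
- exact: fine_energyZ.
- move=> t u v /[dup] t01' /andP[t0 t1] Su Sv.
  apply/fine_energy_le => [|n]; first exact: sobolev_comb.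
  apply: le_trans (fin_energy_convex mu_gt0 w_ge0 r_ge1 n _ _ t01') _.
  by apply: lerD; rewrite ler_wpM2l ?subr_ge0// fin_energy_fine.
- move=> u v Su Sv; apply: fine_energyD_le => [||n].
  + have := sobolev_comb 2^-1 2^-1 Su Sv; congr sobolev.
    by apply/funext => x; rewrite mulrDr.
  + have := sobolev_comb 2^-1 (- 2^-1) Su Sv; congr sobolev.
    by apply/funext => x; rewrite mulrBr mulNr.
  + apply: le_trans (fin_energy_clarkson mu_gt0 w_ge0 r_ge1 n u v) _.
    by rewrite ler_wpM2r// lerD// fin_energy_fine.
- move=> x; exists ((inf (range mu))^-1 `^ p^-1) => u Su.
  rewrite -powRM ?invr_ge0 ?(ltW mu_inf) ?fine_energy_ge0// mulrC.
  by apply: fin_energy_sup_bound => n; exact: fin_energy_fine.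
- move=> u M approx.
  have uM n : FE n u <= M.
    apply: (fin_energy_lsc mu_gt0 w_ge0 r_ge1) => d d0.
    have [v [Sv vM vu]] := approx (exhaust n) d d0; exists v; split => //.
    exact: le_trans (fin_energy_fine n Sv) vM.
  have Su : sobolev G s p u by apply/sobolevP; exists M.
  by split => //; exact/fine_energy_le.
Qed.

Lemma sobolev_normE u : sobolev_norm G s p u = E u `^ p^-1.
Proof. exact: fine_poweR. Qed.

Lemma sobolev_reflexive_banach :
  reflexive_banach_space (sobolev G s p) (sobolev_norm G s p).
Proof.
have := energy_reflexive_banach p_gt1 sobolev_clarkson_energy.
by congr reflexive_banach_space; apply/funext => u; rewrite sobolev_normE.
Qed.

(** The energy depends on [u] only through the numbers [`|u x|] and
    [`|u x - u y|], and is nondecreasing in each of them. *)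
Lemma sobolev_contraction u v : (forall x, `|u x| <= `|v x|) ->
  (forall x y, `|u x - u y| <= `|v x - v y|) ->
  sobolev G s p v -> sobolev G s p u.
Proof.
move=> uv duv /sobolevP[M vM]; apply/sobolevP; exists M => n.
exact: le_trans (fin_energy_le mu_gt0 w_ge0 r_ge1 n uv duv) (vM n).
Qed.

Lemma sobolev_upos u : sobolev G s p u -> sobolev G s p (upos u).
Proof.
apply: sobolev_contraction => [x|x y]; rewrite /upos.
  by case: (leP (u x) 0) => _; rewrite ?normr0.
case: (leP (u x) 0) => ux; case: (leP (u y) 0) => uy;
  rewrite ?subrr ?normr0// ?sub0r ?subr0 ?normrN.
  by rewrite gtr0_norm// ler0_norm ?opprB; lra.
by rewrite gtr0_norm// ger0_norm; lra.
Qed.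

Lemma sobolev_uneg u : sobolev G s p u -> sobolev G s p (uneg u).
Proof.
move=> Su; have := sobolevZ (-1) (sobolev_upos (sobolevZ (-1) Su)).
congr sobolev; apply/funext => x; rewrite /upos /uneg.
by rewrite !mulN1r -[X in Num.max _ X]oppr0 -oppr_min opprK.
Qed.

Lemma sobolev_uabs u : sobolev G s p u -> sobolev G s p (upos u \- uneg u).
Proof.
move=> Su; have := sobolev_comb 1 (-1) (sobolev_upos Su) (sobolev_uneg Su).
by congr sobolev; apply/funext => x; rewrite mul1r mulN1r.
Qed.


Let kappa : R := (inf (range mu))^-1 `^ p^-1.

Lemma sobolev_sup_bound u x : sobolev G s p u ->
  `|u x| <= kappa * sobolev_norm G s p u.
Proof.
move=> Su; rewrite sobolev_normE /kappa -powRM ?invr_ge0 ?(ltW mu_inf) ?fine_energy_ge0//.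
by rewrite mulrC; apply: fin_energy_sup_bound => n; exact: fin_energy_fine.
Qed.

Lemma sobolev_norm_powR u : sobolev_norm G s p u `^ p = E u.
Proof.
by rewrite sobolev_normE -powRrM mulVf ?gt_eqF// powRr1// fine_energy_ge0.
Qed.

(** Interpolation between the [L^p] norm, which is part of the energy, and the
    supremum bound: [`|u x| `^ q] is [`|u x| `^ (q - p) * `|u x| `^ p]. *)
Lemma sobolev_embedded q : (p%:E <= q)%E ->
  embedded_in_Lq G (sobolev G s p) (sobolev_norm G s p) q.
Proof.
move=> pq.
suff [C CP] : exists C : R, forall u, sobolev G s p u ->
    (Lq_norm G q u <= (C * sobolev_norm G s p u)%:E)%E.
  by split; [move=> u /CP H; exact: le_lt_trans H (ltry _) | exists C].
case: q pq => [q| |//]; last first.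
  move=> _; exists kappa => u Su; apply: ge_ereal_sup => _ [x _ <-].
  by rewrite lee_fin sobolev_sup_bound.
rewrite lee_fin => pq; have q0 : 0 < q by exact: lt_le_trans pq.
exists ((kappa `^ (q - p)) `^ q^-1) => u Su; set N := sobolev_norm _ _ _ _.
have N0 : 0 <= N by rewrite /N sobolev_normE powR_ge0.
have k0 : 0 <= kappa by exact: powR_ge0.
have vq : (vint G (fun x => (`|u x| `^ q)%:E) <= (kappa `^ (q - p) * N `^ q)%:E)%E.
  apply/esum_exhaust_le => [x|n].
    by rewrite mule_ge0 ?lee_fin ?powR_ge0// ltW.
  have -> : kappa `^ (q - p) * N `^ q = (kappa * N) `^ (q - p) * E u.
    rewrite powRM// -mulrA; congr (_ * _); rewrite -sobolev_norm_powR -/N.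
    by rewrite -powRD subrK// gt_eqF.
  apply: (@le_trans _ _ ((kappa * N) `^ (q - p) * FE n u)%:E); last first.
    by rewrite lee_fin ler_wpM2l ?powR_ge0// fin_energy_fine.
  rewrite sumEFin lee_fin /fin_energy mulr_sumr ler_sum// => x _.
  have -> : `|u x| `^ q = `|u x| `^ (q - p) * `|u x| `^ p.
    by rewrite -powRD subrK// gt_eqF.
  rewrite mulrAC -mulrA ler_pM ?powR_ge0 ?mulr_ge0 ?powR_ge0 ?(ltW (mu_gt0 x))//.
    by rewrite ge0_ler_powR ?nnegrE ?subr_ge0 ?mulr_ge0// sobolev_sup_bound.
  by rewrite ler_wpM2l ?(ltW (mu_gt0 x))// -sqr_powR lerDr powR_ge0.
rewrite /Lq_norm.
have -> : ((kappa `^ (q - p)) `^ q^-1 * N)%:E = ((kappa `^ (q - p) * N `^ q)%:E `^ q^-1)%E.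
  rewrite poweR_EFin powRM ?powR_ge0//; congr (_ * _)%:E.
  by rewrite -powRrM mulfV ?gt_eqF// powRr1.
apply: gt0_ler_poweR => //; first by rewrite invr_ge0 ltW.
- rewrite in_itv /= leey andbT; apply: esum_ge0 => x _.
  by rewrite mule_ge0 ?lee_fin ?powR_ge0// ltW.
- by rewrite in_itv /= leey andbT lee_fin mulr_ge0 ?powR_ge0.
Qed.

(** An indicator has gradient at [x <> z] proportional to the weight of the
    single pair [(x, z)]; as the exponent [p / 2] is at least [1] and these
    weights are bounded, the energy is controlled by their sum. *)
Lemma sobolev_indicator z : sobolev G s p (fun x => (x == z)%:R).
Proof.
have [D DP] := frac_weight_sum_le Gsc s01 z.
have wD (ys : seq V) : uniq ys -> z \notin ys -> \sum_(y <- ys) w z y <= D.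
  move=> uys zys; rewrite -lee_fin -sumEFin; apply: le_trans (DP ys uys zys).
  rewrite le_eqVlt; apply/orP; left; apply/eqP; rewrite big_seq [RHS]big_seq.
  apply: eq_bigr => y yys; rewrite real_weightE//.
  by apply: contraNneq zys => ->.
have D0 : 0 <= D by have := wD [::] isT isT; rewrite big_nil.
pose m := inf (range mu); pose K := (2 * m)^-1 * D.
have m2 : 0 < 2 * m by rewrite mulr_gt0.
have inv_le x : (2 * mu x)^-1 <= (2 * m)^-1 by rewrite lef_pV2 ?posrE// ler_pM2l.
have K0 : 0 <= K by rewrite mulr_ge0// invr_ge0 ltW.
apply/sobolevP; exists (mu z * (K `^ r + 1) + K `^ (r - 1) * (2^-1 * D)) => n.
set d := (fun x => _).
have split_sum (f : V -> R) : (forall x, 0 <= f x) ->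
    \sum_(x <- exhaust n) f x <= f z + \sum_(x <- exhaust n | x != z) f x.
  move=> f0; have [zn|zn] := boolP (z \in exhaust n).
    by rewrite (bigD1_seq z) ?exhaust_uniq.
  rewrite -[leLHS]add0r lerD// [leRHS]big_seq_cond [leLHS]big_seq le_eqVlt.
  apply/orP; left; apply/eqP; apply: eq_bigl => x.
  by case: (boolP (x \in _)) => //= xn; rewrite (contraTneq _ xn)// => ->.
have sumD : \sum_(y <- exhaust n | y != z) w z y <= D.
  rewrite -big_filter; apply: wD; first by rewrite filter_uniq ?exhaust_uniq.
  by rewrite mem_filter eqxx.
have wle x : x != z -> w z x <= D.
  by move=> xz; have := wD [:: x] isT; rewrite big_seq1; apply; rewrite inE eq_sym.
have gz : gradsq mu w n d z <= K.
  rewrite /gradsq /K ler_pM ?invr_ge0 ?(ltW (mu2_gt0 _))//.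
    by rewrite sumr_ge0// => y _; exact: mulr_ge0 (w_ge0 _ _) (sqr_ge0 _).
  apply: le_trans sumD; rewrite [leRHS]big_mkcond ler_sum// => y _.
  rewrite /d eqxx; have [->|yz] := eqVneq y z.
    by rewrite subrr expr0n mulr0.
  by rewrite subr0 expr1n mulr1.
have gx x : x != z -> gradsq mu w n d x <= (2 * mu x)^-1 * w z x.
  move=> xz; rewrite /gradsq ler_wpM2l ?invr_ge0 ?(ltW (mu2_gt0 _))//.
  apply: le_trans (split_sum _ _) _.
    by move=> y; exact: mulr_ge0 (w_ge0 _ _) (sqr_ge0 _).
  rewrite big1 => [|y yz]; last first.
    by rewrite /d (negbTE xz) (negbTE yz) subrr expr0n mulr0.
  by rewrite /d eqxx (negbTE xz) sub0r sqrrN expr1n mulr1 addr0 real_weightC.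
apply: le_trans (split_sum _ _) _.
  by move=> x; rewrite mulr_ge0 ?addr_ge0 ?powR_ge0// ltW.
apply: lerD.
  rewrite ler_wpM2l ?(ltW (mu_gt0 z))//; apply: lerD.
    by rewrite ge0_ler_powR ?nnegrE ?gradsq_ge0 ?(ltW r_gt0).
  by rewrite /d eqxx expr1n powR1.
apply: (@le_trans _ _ (\sum_(x <- exhaust n | x != z) K `^ (r - 1) * (2^-1 * w z x))).
  apply: ler_sum => x xz.
  rewrite {2}/d (negbTE xz) expr0n powR0 ?gt_eqF// addr0.
  pose a := (2 * mu x)^-1 * w z x.
  have a0 : 0 <= a by rewrite mulr_ge0// invr_ge0 ltW.
  have aK : a <= K by rewrite /a /K ler_pM ?invr_ge0 ?(ltW (mu2_gt0 _)) ?wle.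
  have -> : K `^ (r - 1) * (2^-1 * w z x) = mu x * (a * K `^ (r - 1)).
    by rewrite /a; field; rewrite gt_eqF.
  rewrite ler_wpM2l ?(ltW (mu_gt0 x))//.
  apply: (@le_trans _ _ (a `^ r)).
    by rewrite ge0_ler_powR ?nnegrE ?gradsq_ge0 ?(ltW r_gt0)// gx.
  rewrite -(mulr_powRB1 a0 r_gt0) ler_wpM2l//.
  by rewrite ge0_ler_powR ?nnegrE ?subr_ge0.
by rewrite -mulr_sumr ler_wpM2l ?powR_ge0// -mulr_sumr ler_wpM2l.
Qed.

Lemma sobolev_finite_support : finite_support `<=` sobolev G s p.
Proof.
move=> u /finite_seqP[zs zsE].
have uzs : u = fun x => \sum_(z <- undup zs) u z * (x == z)%:R.
  apply/funext => x; have [xzs|xzs] := boolP (x \in undup zs).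
    rewrite (bigD1_seq x) ?undup_uniq//= eqxx mulr1 big1 ?addr0// => z zx.
    by rewrite eq_sym (negbTE zx) mulr0.
  have ux : u x = 0.
    apply: contrapT => /eqP ux; have : [set x | u x != 0] x by [].
    by rewrite zsE /= => xz; move: xzs; rewrite mem_undup xz.
  rewrite ux big_seq big1// => z zzs; rewrite (_ : x == z = false) ?mulr0//.
  by apply: contraNF xzs => /eqP ->.
rewrite uzs; elim: (undup zs) => [|z ys IH].
  have := sobolev0; congr sobolev; apply/funext => x; by rewrite big_nil.
have := sobolev_comb (u z) 1 (sobolev_indicator z) IH; congr sobolev.
by apply/funext => x; rewrite big_cons mul1r.
Qed.

End SobolevEnergy.

Theorem theorem1 (R : realType) (V : countType) (G : weighted_graph R V)
    (s p : R)
    (Gconn : connected_graph G)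
    (Glf : locally_finite G)
    (Gsc : stochastically_complete G)
    (s_gt0 : 0 < s) (s_lt1 : s < 1)
    (p_ge2 : 2 <= p)
    (mu_inf : 0 < inf (range (vmeas G))) :
  [/\ finite_support `<=` sobolev G s p,
      reflexive_banach_space (sobolev G s p) (sobolev_norm G s p),
      forall q : \bar R, (p%:E <= q)%E ->
        embedded_in_Lq G (sobolev G s p) (sobolev_norm G s p) q
    & forall u : V -> R, sobolev G s p u ->
        [/\ sobolev G s p (upos u), sobolev G s p (uneg u)
          & sobolev G s p (upos u \- uneg u)]].
Proof.
have s01 : 0 < s < 1 by rewrite s_gt0.
split.
- exact: sobolev_finite_support.
- exact: sobolev_reflexive_banach.
- by move=> q; exact: sobolev_embedded.
- move=> u Su; split.
  + exact: sobolev_upos.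
  + exact: sobolev_uneg.
  + exact: sobolev_uabs.
Qed.
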